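(* Let $I,J,M,N\subseteq\{1,\dots,n\}$ with $|I|=|J|$ and $|M|=|N|$. Then in $A=\mathcal{O}_q(M_n(k))$, $$q^{|J\cap N|}[I|J][M|N]+q^{|J\cap N|}\sum_{S\in\{<J\Vert N\}}\lambda_S\,[I|S][M|S^\natural]=q^{|I\cap M|}[M|N][I|J]+q^{|I\cap M|}\sum_{T\in\{>I\Vert M\}}\mu_T\,[T^\natural|N][T|J],$$ where $S^\natural=S^\natural_{J,N}$, $T^\natural=T^\natural_{I,M}$, and $$\lambda_S=\widehat{q}^{\,|J\setminus S|}(-q)^{\mathcal{L}(S,J,N)}\xi_q(J\setminus S;S\setminus J),\qquad \mu_T=\widehat{q}^{\,|T\setminus I|}(-q)^{\mathcal{L}^\natural(T,I,M)}\xi_q(T\setminus I;I\setminus T)$$ for $S\in\{<J\Vert N\}$ and $T\in\{>I\Vert M\}$.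
   Context: Let $k$ be a field, $n$ a positive integer, $q\in k^\times$, and $\widehat{q}=q-q^{-1}$. The algebra $A=\mathcal{O}_q(M_n(k))$ is the $k$-algebra with generators $X_{ij}$ ($1\le i,j\le n$) and relations: $X_{ij}X_{lj}=qX_{lj}X_{ij}$ for $i<l$; $X_{ij}X_{im}=qX_{im}X_{ij}$ for $j<m$; $X_{ij}X_{lm}=X_{lm}X_{ij}$ for $i<l$, $j>m$; $X_{ij}X_{lm}-X_{lm}X_{ij}=\widehat{q}\,X_{im}X_{lj}$ for $i<l$, $j<m$. Quantum minors: for $I=\{i_1<\cdots<i_t\}$ and $J=\{j_1<\cdots<j_t\}$, $[I|J]=\sum_{\sigma\in S_t}(-q)^{\ell(\sigma)}X_{i_1,j_{\sigma(1)}}\cdots X_{i_t,j_{\sigma(t)}}$, where $\ell(\sigma)$ is the length (number of inversions) of $\sigma$; $[\varnothing|\varnothing]=1$. For such $I,J$, $I\le J$ means $i_l\le j_l$ for all $l$; $I<J$ means $I\le J$ and $I\ne J$. For $S,T\subseteq\{1,\dots,n\}$, $\ell(S;T)=|\{(s,t)\in S\times T\mid s>t\}|$. For $d\in\mathbb{N}$, $[d]_{-q}=(-q)^{d-1}+(-q)^{d-3}+\cdots+(-q)^{-(d-1)}$. For index sets $U\ge V$ of the same cardinality $m$, write $U=\{r_1<\cdots<r_m\}$, set $d_l=|[1,r_l]\cap V|-l+1$ (which is $\ge1$) and define $\xi_q(U;V)=[d_1]_{-q}\cdots[d_m]_{-q}$, with $\xi_q(\varnothing;\varnothing)=1$. For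 $X,Y\subseteq\{1,\dots,n\}$: $\{<X\Vert Y\}=\{S\subseteq X\cup Y\mid X\cap Y\subseteq S,\ |S|=|X|,\ S<X\}$ and $\{>X\Vert Y\}=\{T\subseteq X\cup Y\mid X\cap Y\subseteq T,\ |T|=|X|,\ T>X\}$. For $X\cap Y\subseteq S\subseteq X\cup Y$, $S^\natural=S^\natural_{X,Y}=(X\cap Y)\sqcup\bigl((X\cup Y)\setminus S\bigr)$. For $S\in\{<X\Vert Y\}$ and $T\in\{>X\Vert Y\}$ (with $\natural$ taken relative to $X,Y$), $\mathcal{L}(S,X,Y)=\ell\bigl((S\setminus S^\natural)\cup(Y\setminus X);X\setminus S\bigr)-\ell\bigl((S\setminus S^\natural)\cup(Y\setminus X);S\setminus X\bigr)$, $\mathcal{L}^\natural(T,X,Y)=\ell\bigl((T^\natural\setminus T)\cup(X\setminus Y);T\setminus X\bigr)-\ell\bigl((T^\natural\setminus T)\cup(X\setminus Y);X\setminus T\bigr)$. *)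

(* Defs.v *)
From HB Require Import structures.
From mathcomp Require Import all_boot all_fingroup all_algebra.
From mathcomp Require Import generic_quotient ring_quotient.
From mathcomp Require Import boolp.
From mathcomp Require finmap.
From mathcomp Require Import monalg.

Set Implicit Arguments.
Unset Strict Implicit.
Unset Printing Implicit Defensive.

Import GRing.Theory.
Local Open Scope ring_scope.
Local Open Scope quotient_scope.

(* Quotient of an algebra by the two-sided ideal generated by the differences *)
(* u - v with rel u v.                                                        *)

Section RelQuotient.

Variables (k : fieldType) (A : algType k) (rel : A -> A -> Prop).

Inductive rel_ideal_gen : A -> Prop :=
| Rel_ideal_rel u v of rel u v : rel_ideal_gen (u - v)
| Rel_ideal0 : rel_ideal_gen 0
| Rel_idealD u v of rel_ideal_gen u & rel_ideal_gen v : rel_ideal_gen (u + v)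
| Rel_idealMl a u of rel_ideal_gen u : rel_ideal_gen (a * u)
| Rel_idealMr a u of rel_ideal_gen u : rel_ideal_gen (u * a).

Definition rel_ideal : {pred A} := fun u => `[< rel_ideal_gen u >].

Lemma rel_idealP u : reflect (rel_ideal_gen u) (u \in rel_ideal).
Proof. exact: asboolP. Qed.

Lemma rel_ideal_zmod_closed : zmod_closed rel_ideal.
Proof.
split=> [|u v /rel_idealP Iu /rel_idealP Iv]; apply/rel_idealP.
  exact: Rel_ideal0.
by apply: Rel_idealD => //; rewrite -mulN1r; apply: Rel_idealMl.
Qed.

HB.instance Definition _ :=
  GRing.isZmodClosed.Build A rel_ideal rel_ideal_zmod_closed.

Lemma rel_idealMl a u : u \in rel_ideal -> a * u \in rel_ideal.
Proof. by move=> /rel_idealP Iu; apply/rel_idealP/Rel_idealMl. Qed.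

Lemma rel_idealMr a u : u \in rel_ideal -> u * a \in rel_ideal.
Proof. by move=> /rel_idealP Iu; apply/rel_idealP/Rel_idealMr. Qed.

Lemma rel_idealZ c u : u \in rel_ideal -> c *: u \in rel_ideal.
Proof. by rewrite -mulr_algl; apply: rel_idealMl. Qed.

Definition rel_quot : Type := Quotient.quot rel_ideal.

HB.instance Definition _ := EqQuotient.on rel_quot.
HB.instance Definition _ := GRing.Zmodule.on rel_quot.
HB.instance Definition _ := ZmodQuotient.on rel_quot.

Lemma relq_eqP (u v : A) :
  reflect (\pi_rel_quot u = \pi_rel_quot v) (u - v \in rel_ideal).
Proof. by rewrite Quotient.idealrBE; apply: eqP. Qed.

Definition relq_one := lift_cst rel_quot (1 : A).
Definition relq_mul := lift_op2 rel_quot *%R.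
Definition relq_scale (c : k) := lift_op1 rel_quot ( *:%R c).

Lemma relq_repr u : u - repr (\pi_rel_quot u) \in rel_ideal.
Proof. by apply/relq_eqP; rewrite reprK. Qed.

Lemma pi_relq_mul u v : \pi_rel_quot (u * v) = relq_mul (\pi_rel_quot u) (\pi_rel_quot v).
Proof.
unlock relq_mul; apply/relq_eqP; set u' := repr (\pi_rel_quot u); set v' := repr (\pi_rel_quot v).
have -> : u * v - u' * v' = (u - u') * v + u' * (v - v').
  by rewrite mulrBl mulrBr addrA subrK.
by apply: rpredD; [apply/rel_idealMr/relq_repr | apply/rel_idealMl/relq_repr].
Qed.

Lemma pi_relq_scale c u : \pi_rel_quot (c *: u) = relq_scale c (\pi_rel_quot u).
Proof.
by unlock relq_scale; apply/relq_eqP; rewrite -scalerBr; apply/rel_idealZ/relq_repr.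
Qed.

Lemma pi_relq_one : \pi_rel_quot 1 = relq_one.
Proof. by unlock relq_one. Qed.

Lemma pi_relq_add u v : \pi_rel_quot (u + v) = \pi_rel_quot u + \pi_rel_quot v.
Proof. exact: raddfD. Qed.

Lemma pi_relq_sub u v : \pi_rel_quot (u - v) = \pi_rel_quot u - \pi_rel_quot v.
Proof. exact: raddfB. Qed.

Lemma relq_mulA : associative relq_mul.
Proof.
elim/quotW=> x; elim/quotW=> y; elim/quotW=> z.
by rewrite -!pi_relq_mul mulrA.
Qed.

Lemma relq_mul1l : left_id relq_one relq_mul.
Proof. by elim/quotW=> x; rewrite -pi_relq_one -pi_relq_mul mul1r. Qed.

Lemma relq_mul1r : right_id relq_one relq_mul.
Proof. by elim/quotW=> x; rewrite -pi_relq_one -pi_relq_mul mulr1. Qed.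

Lemma relq_mulDl : left_distributive relq_mul +%R.
Proof.
elim/quotW=> x; elim/quotW=> y; elim/quotW=> z.
by rewrite -pi_relq_add -!pi_relq_mul mulrDl pi_relq_add.
Qed.

Lemma relq_mulDr : right_distributive relq_mul +%R.
Proof.
elim/quotW=> x; elim/quotW=> y; elim/quotW=> z.
by rewrite -pi_relq_add -!pi_relq_mul mulrDr pi_relq_add.
Qed.

HB.instance Definition _ := GRing.Zmodule_isPzRing.Build rel_quot
  relq_mulA relq_mul1l relq_mul1r relq_mulDl relq_mulDr.

Lemma relq_scaleA a b x : relq_scale a (relq_scale b x) = relq_scale (a * b) x.
Proof. by elim/quotW: x => x; rewrite -!pi_relq_scale scalerA. Qed.

Lemma relq_scale1 : left_id 1 relq_scale.
Proof. by elim/quotW=> x; rewrite -pi_relq_scale scale1r. Qed.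

Lemma relq_scaleDr : right_distributive relq_scale +%R.
Proof.
move=> c; elim/quotW=> x; elim/quotW=> y.
by rewrite -pi_relq_add -!pi_relq_scale scalerDr pi_relq_add.
Qed.

Lemma relq_scaleDl x : {morph relq_scale^~ x : a b / a + b}.
Proof. by elim/quotW: x => x a b; rewrite -!pi_relq_scale scalerDl pi_relq_add. Qed.

HB.instance Definition _ := GRing.Zmodule_isLmodule.Build k rel_quot
  relq_scaleA relq_scale1 relq_scaleDr relq_scaleDl.

Lemma relq_scaleAl (c : k) (x y : rel_quot) : c *: (x * y) = (c *: x) * y.
Proof.
elim/quotW: x => x; elim/quotW: y => y.
by rewrite -[LHS]/(relq_scale c (relq_mul _ _)) -[RHS]/(relq_mul (relq_scale c _) _)
           -!(pi_relq_mul, pi_relq_scale) scalerAl.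
Qed.

Lemma relq_scaleAr (c : k) (x y : rel_quot) : c *: (x * y) = x * (c *: y).
Proof.
elim/quotW: x => x; elim/quotW: y => y.
by rewrite -[LHS]/(relq_scale c (relq_mul _ _)) -[RHS]/(relq_mul _ (relq_scale c _))
           -!(pi_relq_mul, pi_relq_scale) scalerAr.
Qed.

Lemma pi_relq_rel u v : rel u v -> \pi_rel_quot u = \pi_rel_quot v.
Proof. by move=> uv; apply/relq_eqP/rel_idealP/Rel_ideal_rel. Qed.

Lemma relq_nonzero (f : A -> k) :
    {morph f : u v / u + v} -> {morph f : u v / u * v} -> f 1 = 1 ->
    (forall u v, rel u v -> f u = f v) ->
  1 != 0 :> rel_quot.
Proof.
move=> fD fM f1 frel.
have f0 : f 0 = 0 by apply: (addIr (f 0)); rewrite -fD !add0r.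
have fN u : f (- u) = - f u.
  by apply: (addIr (f u)); rewrite -fD !addNr.
have fI u : rel_ideal_gen u -> f u = 0.
  elim=> {u} [u v /frel fuv||u v _ fu _ fv|a u _ fu|a u _ fu].
  - by rewrite fD fN fuv subrr.
  - exact: f0.
  - by rewrite fD fu fv addr0.
  - by rewrite fM fu mulr0.
  - by rewrite fM fu mul0r.
apply/eqP => E.
have /rel_idealP/fI/eqP : 1 - 0 \in rel_ideal.
  by apply/relq_eqP; rewrite pi_relq_one raddf0.
by rewrite subr0 f1 oner_eq0.
Qed.

End RelQuotient.

Section QuantumRelations.

Variables (k : fieldType) (n : nat) (q : k).
Variables (A : algType k) (X : 'I_n -> 'I_n -> A).

Definition qhat : k := q - q^-1.

(* qmx_rel u v: "u = v" is a defining relation of O_q(M_n(k)) *)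
Inductive qmx_rel : A -> A -> Prop :=
| Qmx_col (i l j : 'I_n) of (i < l)%N :
    qmx_rel (X i j * X l j) (q *: (X l j * X i j))
| Qmx_row (i j m : 'I_n) of (j < m)%N :
    qmx_rel (X i j * X i m) (q *: (X i m * X i j))
| Qmx_anti (i l j m : 'I_n) of (i < l)%N & (m < j)%N :
    qmx_rel (X i j * X l m) (X l m * X i j)
| Qmx_diag (i l j m : 'I_n) of (i < l)%N & (j < m)%N :
    qmx_rel (X i j * X l m - X l m * X i j) (qhat *: (X i m * X l j)).

Lemma qmx_rel_nonzero (f : A -> k) :
    {morph f : u v / u + v} -> {morph f : u v / u * v} -> f 1 = 1 ->
    (forall c u, f (c *: u) = c * f u) -> (forall i j, f (X i j) = 0) ->
  1 != 0 :> rel_quot qmx_rel.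
Proof.
move=> fD fM f1 fZ fX; apply: (relq_nonzero fD fM f1) => u v.
have fXX i j l m : f (X i j * X l m) = 0 by rewrite fM fX mul0r.
have fXXB i j l m i' j' l' m' : f (X i j * X l m - X i' j' * X l' m') = 0.
  by rewrite -scaleN1r fD fZ !fXX mulr0 addr0.
case=> *; rewrite ?fXXB ?fZ ?fXX ?mulr0 //.
Qed.

Local Notation Q := (rel_quot qmx_rel).
Local Notation Y i j := (\pi_Q (X i j)).

Lemma relq_col (i l j : 'I_n) : (i < l)%N ->
  Y i j * Y l j = q *: (Y l j * Y i j).
Proof.
by move=> il; have := pi_relq_rel (Qmx_col j il);
  rewrite pi_relq_scale !pi_relq_mul.
Qed.

Lemma relq_row (i j m : 'I_n) : (j < m)%N ->
  Y i j * Y i m = q *: (Y i m * Y i j).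
Proof.
by move=> jm; have := pi_relq_rel (Qmx_row i jm);
  rewrite pi_relq_scale !pi_relq_mul.
Qed.

Lemma relq_anti (i l j m : 'I_n) : (i < l)%N -> (m < j)%N ->
  Y i j * Y l m = Y l m * Y i j.
Proof.
by move=> il mj; have := pi_relq_rel (Qmx_anti il mj); rewrite !pi_relq_mul.
Qed.

Lemma relq_diag (i l j m : 'I_n) : (i < l)%N -> (j < m)%N ->
  Y i j * Y l m - Y l m * Y i j = qhat *: (Y i m * Y l j).
Proof.
by move=> il jm; have := pi_relq_rel (Qmx_diag il jm);
  rewrite pi_relq_sub pi_relq_scale !pi_relq_mul.
Qed.

End QuantumRelations.

(* The free algebra on the X_ij is the monoid algebra of the free monoid on   *)
(* the index pairs.                                                           *)

Section FreeAlgebra.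

Variables (k : fieldType) (n : nat).

Definition free_mx : Type := {malg k[{fmonom ('I_n * 'I_n)%type}]}.

HB.instance Definition _ := GRing.Lalgebra.on free_mx.

Lemma malg_scalerAr (K : monomType) (c : k) (u v : {malg k[K]}) :
  c *: (u * v) = u * (c *: v).
Proof.
apply/malgP => w; rewrite mcoeffZ mcoeffMl.
rewrite (mcoeffMlw _ (finmap.fsubset_refl _) (msuppZ_le c v)) mulr_sumr.
apply: eq_bigr => m1 _; rewrite mulr_sumr; apply: eq_bigr => m2 _.
by rewrite mcoeffZ mulrnAr mulrCA.
Qed.

HB.instance Definition _ :=
  GRing.Lalgebra_isAlgebra.Build k free_mx (@malg_scalerAr _).

Definition free_X (i j : 'I_n) : free_mx := << fmu (i, j) >>.

End FreeAlgebra.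

Section QuantumMatrices.

Variables (k : fieldType) (n : nat) (q : k).

Definition Oq_mx : Type := rel_quot (qmx_rel q (@free_X k n)).

HB.instance Definition _ := GRing.PzRing.on Oq_mx.
HB.instance Definition _ := GRing.Lmodule.on Oq_mx.

Lemma Oq_nonzero : 1 != 0 :> Oq_mx.
Proof.
apply: (@qmx_rel_nonzero k n q (free_mx k n) (@free_X k n)
  (@mcoeff {fmonom ('I_n * 'I_n)%type} k mone)).
- exact: raddfD.
- by case: (@mcoeff1g_is_multiplicative {fmonom ('I_n * 'I_n)%type} k).
- by case: (@mcoeff1g_is_multiplicative {fmonom ('I_n * 'I_n)%type} k).
- by move=> c u; apply: mcoeffZ.
- by move=> i j; rewrite mcoeffU1 fm1_eq1.
Qed.

HB.instance Definition _ := GRing.PzSemiRing_isNonZero.Build Oq_mx Oq_nonzero.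
HB.instance Definition _ :=
  GRing.Lmodule_isLalgebra.Build k Oq_mx (@relq_scaleAl _ _ _).
HB.instance Definition _ :=
  GRing.Lalgebra_isAlgebra.Build k Oq_mx (@relq_scaleAr _ _ _).

Definition Oq_X (i j : 'I_n) : Oq_mx :=
  \pi_(rel_quot (qmx_rel q (@free_X k n))) (free_X k i j).

Lemma Oq_col (i l j : 'I_n) : (i < l)%N ->
  Oq_X i j * Oq_X l j = q *: (Oq_X l j * Oq_X i j).
Proof. exact: relq_col. Qed.

Lemma Oq_row (i j m : 'I_n) : (j < m)%N ->
  Oq_X i j * Oq_X i m = q *: (Oq_X i m * Oq_X i j).
Proof. exact: relq_row. Qed.

Lemma Oq_anti (i l j m : 'I_n) : (i < l)%N -> (m < j)%N ->
  Oq_X i j * Oq_X l m = Oq_X l m * Oq_X i j.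
Proof. exact: relq_anti. Qed.

Lemma Oq_diag (i l j m : 'I_n) : (i < l)%N -> (j < m)%N ->
  Oq_X i j * Oq_X l m - Oq_X l m * Oq_X i j = qhat q *: (Oq_X i m * Oq_X l j).
Proof. exact: relq_diag. Qed.

Definition perm_length t (s : 'S_t) : nat :=
  #|[set p : 'I_t * 'I_t | (p.1 < p.2)%N && (s p.2 < s p.1)%N]|.

(* For a set I of ordinals, enum I lists the elements of I increasingly and   *)
(* enum_val l is its l-th entry (from 0).  The default value of nth is never  *)
(* used when #|I| = #|J|.                                                     *)
Definition qminor (I J : {set 'I_n}) : Oq_mx :=
  \sum_(s : 'S_#|I|) (- q) ^+ perm_length s *:
    \prod_(l < #|I|) Oq_X (enum_val l) (nth (enum_val l) (enum J) (s l)).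

Definition qbracket (d : nat) : k :=
  \sum_(i < d) (- q) ^ ((d%:Z - 1) - (2 * i)%N%:Z).

(* r_l and d_l are indexed from l = 0 here, so "- l + 1" becomes "- l"; the   *)
(* truncated subtraction is exact when V <= U.                                *)
Definition xi (U V : {set 'I_n}) : k :=
  \prod_(l < #|U|)
    qbracket (#|[set v in V | (v <= enum_val l)%N]| - l)%N.

End QuantumMatrices.

Section IndexSets.

Variable n : nat.
Implicit Types (I J S T X Y : {set 'I_n}).

(* all2 also requires the two lists to have the same length *)
Definition iset_le I J : bool :=
  all2 (fun i j : 'I_n => (i <= j)%N) (enum I) (enum J).

Definition iset_lt I J : bool := iset_le I J && (I != J).

Definition ell S T : nat :=
  #|[set p : 'I_n * 'I_n | [&& p.1 \in S, p.2 \in T & (p.2 < p.1)%N]]|.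

Definition lower_isets X Y : {set {set 'I_n}} :=
  [set S : {set 'I_n} |
    [&& S \subset X :|: Y, X :&: Y \subset S, #|S| == #|X| & iset_lt S X]].

Definition upper_isets X Y : {set {set 'I_n}} :=
  [set T : {set 'I_n} |
    [&& T \subset X :|: Y, X :&: Y \subset T, #|T| == #|X| & iset_lt X T]].

Definition natural X Y S : {set 'I_n} := (X :&: Y) :|: ((X :|: Y) :\: S).

Definition calL S X Y : int :=
  let Z := (S :\: natural X Y S) :|: (Y :\: X) in
  (ell Z (X :\: S))%:Z - (ell Z (S :\: X))%:Z.

Definition calLnat T X Y : int :=
  let Z := (natural X Y T :\: T) :|: (X :\: Y) in
  (ell Z (T :\: X))%:Z - (ell Z (X :\: T))%:Z.

End IndexSets.

Definition lambda_coef (k : fieldType) (n : nat) (q : k)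
    (J N S : {set 'I_n}) : k :=
  qhat q ^+ #|J :\: S| * (- q) ^ calL S J N * xi q (J :\: S) (S :\: J).

Definition mu_coef (k : fieldType) (n : nat) (q : k)
    (I M T : {set 'I_n}) : k :=
  qhat q ^+ #|T :\: I| * (- q) ^ calLnat T I M * xi q (T :\: I) (I :\: T).

(* Main.v *)
(* O_q(M_n) is a braided bialgebra, and the identity is the braiding relation
     sum_{S,S'} R(S,S'; J,N) [I|S][M|S'] = sum_{T,T'} R(I,M; T,T') [T'|N][T|J]
   for the R-matrix of a pair of quantum exterior powers.  For single generators
   it is the defining relations; it propagates to minors by Laplace expansion
   along the first row, provided that R satisfies the fusion identity
   [braid_fuse] expressing that multiplication V (x) Lambda -> Lambda is
   compatible with the braiding.
   R(S,S'; J,N) is a product over x = 1..n of six-vertex weights that depend only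
   on the membership of x in S, S', J, N and on the height
   h(x) = #{s in S | s < x} - #{j in J | j < x}.  With p = -q, the weight at
   x in J \ S is p^-h - p^h = (q - q^-1) [h]_p; it vanishes at h = 0, which forces
   S <= J, and the product of these factors is the product of brackets xi_q. *)

Require Import Defs.
From mathcomp Require Import all_boot all_fingroup all_algebra.
From mathcomp Require Import ring zify.

Set Implicit Arguments.
Unset Strict Implicit.
Unset Printing Implicit Defensive.

Import GRing.Theory.
Local Open Scope ring_scope.

(** * Quantum minors with rows indexed by a word *)

(** The bound is a natural number and not an ordinal, so that [x.+1] and [n] may serve as bounds in
    inductions over positions. *)
Definition cnt_lt n (m : nat) (J : {set 'I_n}) : nat :=
  #|[set x in J | (x < m)%N]|.

Section EnumOrd.
Variable n : nat.
Implicit Types J : {set 'I_n}.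

Lemma sorted_enum_set J : sorted (fun x y : 'I_n => (x < y)%N) (enum J).
Proof.
have tr : transitive (fun x y : 'I_n => (x < y)%N) by move=> y x z; apply: ltn_trans.
rewrite {1}/enum_mem; apply: sorted_filter => //.
rewrite -enumT; have := iota_ltn_sorted 0 n.
by rewrite -val_enum_ord sorted_map.
Qed.

Lemma enum_val_ltn J (l m : 'I_#|J|) : (enum_val l < enum_val m)%N = (l < m)%N.
Proof.
have x0 : 'I_n := enum_val l.
have mono a b : (a < b)%N -> (b < #|J|)%N ->
    (nth x0 (enum J) a < nth x0 (enum J) b)%N.
  move=> ab bJ; apply: (sorted_ltn_nth _ x0 (sorted_enum_set J)) => //.
  - by move=> y x z; apply: ltn_trans.
  - by rewrite inE -cardE (ltn_trans ab).
  - by rewrite inE -cardE.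
rewrite !(enum_val_nth x0).
case: (ltngtP l m) => [lm|ml|/val_inj ->]; last by rewrite ltnn.
- by rewrite mono.
- by apply/negbTE; rewrite -leqNgt ltnW ?mono.
Qed.

Lemma cnt_lt_enum_val J (l : 'I_#|J|) : cnt_lt (enum_val l) J = l.
Proof.
have -> : cnt_lt (enum_val l) J = (\sum_(x in J) (x < enum_val l))%N.
  rewrite /cnt_lt -sum1_card big_mkcond [RHS]big_mkcond /=.
  by apply: eq_bigr => x _; rewrite inE; case: (x \in J); case: ltnP.
rewrite big_enum_val /=; under eq_bigr => x _ do rewrite enum_val_ltn.
rewrite -(big_mkord xpredT (fun y => nat_of_bool (y < l)%N)).
have jt := ltnW (ltn_ord l).
rewrite (big_cat_nat (n := l)) //=.
rewrite [X in (X + _)%N](eq_big_nat _ _ (F2 := fun => 1%N)); last first.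
  by move=> y /andP[_ ->].
rewrite [X in (_ + X)%N]big_nat_cond [X in (_ + X)%N]big1 => [|y /andP[/andP[h _] _]].
  by rewrite sum_nat_const_nat muln1 subn0 addn0.
by rewrite ltnNge h.
Qed.

(** Deleting the l-th column renumbers the others by [bump l], the function behind [lift l]; this
    matches column sets with the reindexing of permutations. *)
Lemma nth_enum_rem x0 J l i : (l < #|J|)%N ->
  nth x0 (enum (J :\ nth x0 (enum J) l)) i = nth x0 (enum J) (bump l i).
Proof.
move=> lJ; set j := nth _ _ l.
have lJ' : (l < size (enum J))%N by rewrite -cardE.
have jJ : j \in enum J by apply: mem_nth.
have -> : enum (J :\ j) = rem j (enum J).
  rewrite rem_filter ?enum_uniq // {1}/enum_mem [in RHS]/enum_mem -filter_predI.
  by apply: eq_filter => x; rewrite !inE.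
rewrite remE index_uniq ?enum_uniq // nth_cat size_take lJ' /bump.
case: leqP => li; first by rewrite nth_drop; congr nth; lia.
by rewrite nth_take.
Qed.

End EnumOrd.

(** * Laplace expansion of quantum minors along the first row *)

Section RecMinor.

Variables (k : fieldType) (n : nat) (q : k).

Section Expansion.
Variables (A : algType k) (X : 'I_n -> 'I_n -> A).

(** Rows and columns are functions here, so that deleting the first row and the j-th column is
    composition with [lift]. *)
Definition gminor t (f g : 'I_t -> 'I_n) : A :=
  \sum_(s : 'S_t) (- q) ^+ perm_length s *: \prod_(l < t) X (f l) (g (s l)).

Lemma perm_lengthE t (s : 'S_t) :
  perm_length s = (\sum_(x < t) \sum_(y < t) ((x < y) && (s y < s x)))%N.
Proof.
rewrite /perm_length -sum1_card pair_big /= big_mkcond /=.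
by apply: eq_bigr => p _; rewrite inE; case: ifP.
Qed.

(** The first position is inverted with the [j] later positions whose value lies below [j]. The
    remaining inversions are those of [s], because [lift] is increasing. *)
Lemma perm_length_lift t (j : 'I_t.+1) (s : 'S_t) :
  perm_length (lift_perm ord0 j s) = (j + perm_length s)%N.
Proof.
rewrite !perm_lengthE big_ord_recl; congr addn.
  rewrite big_ord_recl ltnn /= add0n.
  under eq_bigr => y _ do rewrite lift_perm_lift lift_perm_id /=.
  (* The sum over positions y becomes a sum over the values s y. *)
  rewrite -(reindex_inj (@perm_inj _ s) (P := xpredT)
    (F := fun y => nat_of_bool (lift j y < j)%N)).
  have E (y : 'I_t) : ((lift j y < j) = (y < j))%N.
    by rewrite /= /bump; case: leqP => h; lia.
  under eq_bigr => y _ do rewrite E.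
  rewrite -(big_mkord xpredT (fun y => nat_of_bool (y < j)%N)).
  have jt : (j <= t)%N by rewrite -ltnS.
  rewrite (big_cat_nat (n := j)) //=.
  rewrite [X in (X + _)%N](eq_big_nat _ _ (F2 := fun => 1%N)); last first.
    by move=> y /andP[_ ->].
  rewrite [X in (_ + X)%N]big_nat_cond [X in (_ + X)%N]big1 => [|y /andP[/andP[h _] _]].
    by rewrite sum_nat_const_nat muln1 subn0 addn0.
  by rewrite ltnNge h.
apply: eq_bigr => x _; rewrite big_ord_recl ltn0 /= add0n.
apply: eq_bigr => y _; rewrite !lift_perm_lift /= /bump !leq0n !add1n ltnS.
by congr (nat_of_bool (_ && _)); rewrite /bump; lia.
Qed.

Lemma lift_perm_pair_bij t :
  bijective (fun p : 'I_t.+1 * 'S_t => lift_perm ord0 p.1 p.2).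
Proof.
apply: inj_card_bij => [[i s] [j r] /= e|]; last by rewrite card_prod !card_Sn card_ord factS.
have ij : i = j by have /permP/(_ ord0) := e; rewrite !lift_perm_id.
rewrite ij in e *; congr (_, _); apply/permP => x.
by apply: (@lift_inj _ j); rewrite -!(lift_perm_lift ord0) e.
Qed.

(** Permutations are sorted by the image j of the first position, which contributes j inversions. *)
Lemma gminor_recl t (f g : 'I_t.+1 -> 'I_n) :
  gminor f g = \sum_(j < t.+1) (- q) ^+ j *:
    (X (f ord0) (g j) * gminor (f \o lift ord0) (g \o lift j)).
Proof.
rewrite /gminor (reindex _ (onW_bij _ (lift_perm_pair_bij t))) /=.
rewrite -(pair_bigA _ (fun j s => (- q) ^+ perm_length (lift_perm ord0 j s) *:
  \prod_(l < t.+1) X (f l) (g (lift_perm ord0 j s l)))) /=.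
apply: eq_bigr => j _; rewrite mulr_sumr scaler_sumr; apply: eq_bigr => s _.
rewrite perm_length_lift exprD -scalerA -scalerAr big_ord_recl lift_perm_id.
congr (_ *: (_ *: (_ * _))); apply: eq_bigr => l _.
by rewrite lift_perm_lift.
Qed.

(* The rows form a word, so that they may be repeated or out of order. *)
Fixpoint wminor (w : seq 'I_n) (J : {set 'I_n}) : A :=
  if w is a :: w' then
    \sum_(j in J) (- q) ^+ cnt_lt j J *: (X a j * wminor w' (J :\ j))
  else (J == set0)%:R.

Lemma wminor_size w (J : {set 'I_n}) : size w != #|J| -> wminor w J = 0.
Proof.
elim: w J => [|a w IH] J /=.
  by rewrite eq_sym cards_eq0 => /negPf ->.
move=> h; apply: big1 => j jJ; rewrite IH ?mulr0 ?scaler0 //.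
by move: h; rewrite (cardsD1 j J) jJ add1n eqSS.
Qed.

(** Both sides obey the same first-row expansion: the j-th column of J, counted from 0, has exactly
    j columns of J below it. *)
Lemma wminor_gminor t w (J : {set 'I_n}) x0 : size w = t -> #|J| = t ->
  wminor w J = gminor (fun l : 'I_t => nth x0 w l) (fun l => nth x0 (enum J) l).
Proof.
move=> <-{t} /esym; elim: w J => [|a w IH] J /= hJ.
  rewrite -cards_eq0 -hJ /gminor (big_pred1 1%g) => [|s]; last first.
    by apply/esym/eqP/permP; case.
  by rewrite big_ord0 perm_lengthE big_ord0 expr0 scale1r.
rewrite gminor_recl big_enum_val /=.
rewrite (reindex (cast_ord hJ)) /=; last first.
  by exists (cast_ord (esym hJ)) => x _; rewrite ?cast_ordK ?cast_ordKV.
apply: eq_bigr => j _; rewrite cnt_lt_enum_val /=.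
have -> : enum_val (cast_ord hJ j) = nth x0 (enum J) j by rewrite (enum_val_nth x0).
congr (_ *: (_ * _)); rewrite IH; last first.
  have jJ : nth x0 (enum J) j \in J.
    by rewrite -mem_enum mem_nth // -cardE -[X in (_ < X)%N]hJ.
  by apply: succn_inj; rewrite [LHS]hJ (cardsD1 (nth x0 (enum J) j) J) jJ.
apply: eq_bigr => s _; congr (_ *: _); apply: eq_bigr => l _.
by rewrite /= nth_enum_rem // -[X in (_ < X)%N]hJ.
Qed.

End Expansion.
End RecMinor.

Section EnumMin.
Variable n : nat.
Implicit Types (a j l : 'I_n) (J T : {set 'I_n}).

Lemma enum_setU1_min a T : (forall x, x \in T -> (a < x)%N) ->
  enum (a |: T) = a :: enum T.
Proof.
move=> aT; apply: (@irr_sorted_eq _ (fun x y : 'I_n => (x < y)%N)).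
- by move=> y x z; apply: ltn_trans.
- by move=> x; rewrite ltnn.
- exact: sorted_enum_set.
- rewrite /= path_min_sorted ?sorted_enum_set //.
  by apply/allP => x; rewrite mem_enum; apply: aT.
- by move=> x; rewrite !(mem_enum, inE).
Qed.

Lemma min_elt J : J != set0 ->
  exists2 i, i \in J & forall x, x \in J :\ i -> (i < x)%N.
Proof.
case/set0Pn => x0 x0J; case: (arg_minnP (fun x : 'I_n => x : nat) x0J) => i iJ mi.
exists i => // x; rewrite !inE => /andP[xi xJ].
by rewrite ltn_neqAle mi // andbT eq_sym (inj_eq val_inj).
Qed.

Lemma cnt_lt0 a T : (forall x, x \in T -> (a < x)%N) -> cnt_lt a T = 0%N.
Proof.
move=> aT; apply/eqP; rewrite cards_eq0; apply/eqP/setP => x; rewrite !inE.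
by apply/andP => -[/aT]; lia.
Qed.

Lemma cnt_lt_setU1 a j T : j \notin T -> cnt_lt a (j |: T) = ((j < a) + cnt_lt a T)%N.
Proof.
move=> jT; rewrite /cnt_lt; case: ltnP => ja.
  have -> : [set x in j |: T | (x < a)%N] = j |: [set x in T | (x < a)%N].
    by apply/setP => x; rewrite !inE; case: eqP => // ->; rewrite ja.
  by rewrite cardsU1 inE (negPf jT).
apply: eq_card => x; rewrite !inE; case: eqP => // ->.
by rewrite (negPf jT) /= ltnNge ja.
Qed.

Lemma cnt_ltD1 a j T : j \in T -> cnt_lt a T = ((j < a) + cnt_lt a (T :\ j))%N.
Proof. by move=> jT; rewrite -{1}(setD1K jT) cnt_lt_setU1 // !inE eqxx. Qed.

Lemma sum_ordered_pairs (V : zmodType) J (F : 'I_n -> 'I_n -> V) :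
  \sum_(j in J) \sum_(l in J :\ j) F j l =
  \sum_(j in J) \sum_(l in J | (j < l)%N) (F j l + F l j).
Proof.
have E : \sum_(j in J) \sum_(l in J :\ j) F j l =
    \sum_(j in J) (\sum_(l in J | (j < l)%N) F j l + \sum_(l in J | (l < j)%N) F j l).
  apply: eq_bigr => j jJ; rewrite (bigID (fun l : 'I_n => (j < l)%N)) /=.
  by congr (_ + _); apply: eq_bigl => l; rewrite !inE -val_eqE /=;
    case: ltngtP => //; rewrite ?andbT ?andbF.
rewrite E big_split /=; under [RHS]eq_bigr do rewrite big_split.
rewrite [RHS]big_split /=; congr (_ + _).
rewrite (exchange_big_dep (mem J)) //=; last by move=> j l _ /andP[].
apply: eq_bigr => l lJ; apply: eq_bigl => j; rewrite lJ /=.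
by rewrite andbC.
Qed.

End EnumMin.

(** * Exchange of rows in a minor indexed by a word *)

Section Laplace.

Variables (k : fieldType) (n : nat) (q : k) (A : algType k).
Variable X : 'I_n -> 'I_n -> A.

Hypothesis Xcol : forall i l j : 'I_n, (i < l)%N ->
  X i j * X l j = q *: (X l j * X i j).
Hypothesis Xrow : forall i j m : 'I_n, (j < m)%N ->
  X i j * X i m = q *: (X i m * X i j).
Hypothesis Xanti : forall i l j m : 'I_n, (i < l)%N -> (m < j)%N ->
  X i j * X l m = X l m * X i j.
Hypothesis Xdiag : forall i l j m : 'I_n, (i < l)%N -> (j < m)%N ->
  X i j * X l m - X l m * X i j = qhat q *: (X i m * X l j).
Hypothesis q0 : q != 0.

Implicit Types (a b i j l : 'I_n) (J T : {set 'I_n}).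

Local Notation W := (wminor q X).

(** Two expansions remove columns j and l in either order. Removing the larger one first costs one
    more factor -q, so the two orders combine into a 2 by 2 quantum minor. *)
Lemma wminor_cons2 a b w J : W [:: a, b & w] J =
  \sum_(j in J) \sum_(l in J | (j < l)%N)
    (- q) ^+ (cnt_lt j J + cnt_lt l (J :\ j)) *:
      ((X a j * X b l - q *: (X a l * X b j)) * W w (J :\ j :\ l)).
Proof.
rewrite /=; under eq_bigr do rewrite mulr_sumr scaler_sumr.
rewrite sum_ordered_pairs; apply: eq_bigr => j jJ; apply: eq_bigr => l /andP[lJ jl].
have -> : J :\ l :\ j = J :\ j :\ l by rewrite !setDDl setUC.
rewrite (cnt_ltD1 j lJ) (cnt_ltD1 l jJ) jl ltnNge (ltnW jl) add0n.
rewrite -!scalerAr !scalerA -exprD mulrBl scalerBr -!mulrA; congr (_ + _).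
rewrite -scalerAl scalerA -scaleNr mulrA; congr (_ *: _).
by rewrite add1n exprS exprD; ring.
Qed.

Lemma wminor_rep a w J : W [:: a, a & w] J = 0.
Proof.
rewrite wminor_cons2 big1 // => j jJ; rewrite big1 // => l /andP[lJ jl].
by rewrite Xrow // subrr mul0r scaler0.
Qed.

(** By [wminor_cons2] it suffices to compare the 2 by 2 factors, where the claim follows from
    [Xanti], [Xdiag] and -q (q - q^-1) = 1 - q^2. *)
Lemma wminor_swap a i w J : (i < a)%N ->
  W [:: a, i & w] J = - q *: W [:: i, a & w] J.
Proof.
move=> ia; rewrite !wminor_cons2 scaler_sumr; apply: eq_bigr => j jJ.
rewrite scaler_sumr; apply: eq_bigr => l /andP[lJ jl].
rewrite scalerA [- q * _]mulrC -scalerA; congr (_ *: _); rewrite [RHS]scalerAl; congr (_ * _).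
rewrite (Xanti ia jl); have /eqP := Xdiag ia jl; rewrite subr_eq => /eqP ->.
rewrite (Xanti ia jl) !scalerBr scalerDr !scalerA /qhat.
have -> : - q * (q - q^-1) = 1 - q * q by field.
by rewrite scalerBl scale1r mulNr !scaleNr opprK addrAC subrK addrC.
Qed.

(** The new row moves past the smaller rows of T at the price of -q each; if it meets an equal row
    the minor vanishes. The rows thus multiply as in a quantum exterior algebra. *)
Lemma wminor_cons_set a T J :
  W (a :: enum T) J =
  ((a \notin T)%:R * (- q) ^+ cnt_lt a T) *: W (enum (a |: T)) J.
Proof.
move: {2}#|T| (erefl #|T|) => m; elim: m T a J => [|m IH] T a J Tm.
  move/eqP: Tm; rewrite cards_eq0 => /eqP ->.
  by rewrite enum_set0 setU0 enum_set1 inE cnt_lt0 ?expr0 ?mulr1 ?scale1r // => x; rewrite inE.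
have [|i iT mi] := @min_elt _ T; first by rewrite -cards_eq0 Tm.
have eT : enum T = i :: enum (T :\ i) by rewrite -enum_setU1_min ?setD1K.
have := Tm; rewrite (cardsD1 i) iT add1n => -[Tm'].
case: (ltngtP a i) => ai.
- have aT x : x \in T -> (a < x)%N.
    by case: (eqVneq x i) => [->//|xi] xT; apply: ltn_trans ai (mi _ _); rewrite !inE xi.
  rewrite enum_setU1_min // cnt_lt0 // mulr1; case: (boolP (a \in T)) => [/aT|_].
    by rewrite ltnn.
  by rewrite scale1r.
- have ain : (a == i) = false by apply/eqP => e; rewrite e ltnn in ai.
  rewrite eT wminor_swap //.
  (* The row i is expanded so that the induction hypothesis can sort a into T \ i inside each
     summand; the expansion is then folded back. *)
  rewrite -[W (i :: _) J]/(\sum_(j in J) (- q) ^+ cnt_lt j J *: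
    (X i j * W (a :: enum (T :\ i)) (J :\ j))).
  under eq_bigr do rewrite IH // -scalerAr scalerA mulrC -scalerA.
  rewrite -scaler_sumr -[\sum_(j in J) _]/(W (i :: enum (a |: T :\ i)) J).
  rewrite -enum_setU1_min; last first.
    by move=> x; rewrite inE in_set1 => /orP[/eqP ->|/mi].
  rewrite scalerA setUCA setD1K // !inE ain (cnt_ltD1 a iT) ai exprS.
  by congr (_ *: _); rewrite /=; ring.
- by rewrite eT (val_inj ai) wminor_rep iT mul0r scale0r.
Qed.

End Laplace.

(** * The braiding of the vector representation with exterior powers *)

Section RowBraiding.

Variables (k : fieldType) (n : nat) (q : k).
Hypothesis q0 : q != 0.
Implicit Types (a c d i j l m : 'I_n) (K M N T : {set 'I_n}).

(* [braid11], [braid1] and [braid] are the matrices of the braiding on V (x) V,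
   V (x) Lambda^t and Lambda^s (x) Lambda^t. *)
Definition braid11 a c l d : k :=
  ((a == l) && (c == d))%:R * q ^+ (a == c)
  + [&& a == d, c == l & (a < c)%N]%:R * qhat q.

(* The exponent is minus the number of elements of N strictly between a and j. *)
Definition braid1 a K j N : k :=
  if a == j then (K == N)%:R * q ^+ (a \in N)
  else [&& (a < j)%N, a \in N, j \notin N & K == j |: N :\ a]%:R
       * (qhat q * (- q) ^+ (cnt_lt a N).+1 * (- q) ^- cnt_lt j N).

Lemma setU1_eq c K N : c \notin K -> (c |: K == N) = (c \in N) && (K == N :\ c).
Proof.
move=> cK; apply/eqP/andP => [<-|[cN /eqP ->]]; last by rewrite setD1K.
by rewrite !inE eqxx setU1K.
Qed.

Lemma setD1_neq c K N : c \in K -> (K == N :\ c) = false.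
Proof. by move=> cK; apply/eqP => e; move: cK; rewrite e !inE eqxx. Qed.

(** This is [braid1_fuse] with its sums evaluated: [braid11] leaves only d = c, l = a and, if a < c,
    also d = a, l = c. The proof distinguishes the relative order of a, c, j and membership in N;
    each case is a rational identity in q. *)
Lemma braid1_fuse_explicit a c K j N :
  (c \notin K)%:R * (- q) ^+ cnt_lt c K * braid1 a (c |: K) j N =
  (c \in N)%:R * (- q) ^+ cnt_lt c N * q ^+ (a == c) * braid1 a K j (N :\ c)
  + ((a \in N) && (a < c)%N)%:R * (- q) ^+ cnt_lt a N * qhat q * braid1 c K j (N :\ a).
Proof.
have p0 : - q != 0 by rewrite oppr_eq0.
have pX (x : nat) : (- q) ^+ x != 0 by apply: expf_neq0.
have [->{a}|ac] := eqVneq a c.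
  rewrite ltnn andbF !mul0r addr0 /braid1 expr1.
  case: (eqVneq c j) => [_|cj]; last first.
    have -> : (c |: K == j |: N :\ c) = false.
      by apply/eqP => /setP/(_ c); rewrite !inE eqxx (negPf cj).
    by rewrite !inE eqxx !andbF !mul0r !mulr0.
  have [cK|cK] := boolP (c \in K); first by rewrite setD1_neq // !mul0r !mulr0.
  rewrite setU1_eq //; have [cN|cN] := boolP (c \in N); last by rewrite !mul0r mulr0.
  case: eqP => [->|_]; last by rewrite !mul0r !mulr0.
  by rewrite (cnt_ltD1 c cN) ltnn add0n !inE eqxx /=; ring.
have ca : c == a = false by rewrite eq_sym; apply: negbTE.
rewrite expr0 mulr1 /braid1.
have [<-{j}|aj] := eqVneq a j.
  rewrite ca.
  have -> : ((a \in N) && (a < c)%N)%:R * (- q) ^+ cnt_lt a N * qhat q *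
      ([&& (c < a)%N, c \in N :\ a, a \notin N :\ a & K == a |: N :\ a :\ c]%:R
       * (qhat q * (- q) ^+ (cnt_lt c (N :\ a)).+1 * (- q) ^- cnt_lt a (N :\ a))) = 0.
    by case: ltngtP => _; rewrite ?andbF !(mul0r, mulr0).
  rewrite addr0.
  have [cK|cK] := boolP (c \in K); first by rewrite setD1_neq // !mul0r mulr0.
  rewrite setU1_eq //; have [cN|cN] := boolP (c \in N); last by rewrite !mul0r mulr0.
  case: eqP => [->|_]; last by rewrite !mul0r !mulr0.
  by rewrite (cnt_ltD1 c cN) ltnn add0n !inE ac /=; ring.
have [aN|aN] := boolP (a \in N); last by rewrite !inE (negPf aN) !andbF !(mul0r, mulr0) add0r.
have [ltaj|ltja|/val_inj eaj] := ltngtP a j; last by rewrite eaj eqxx in aj.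
- have [ecj|cj] := eqVneq c j.
    rewrite -{}ecj {j aj} in ltaj *.
    have [cN|cN] := boolP (c \in N).
      (* The left side is zero because c = j lies in N; the two terms on the right are both
         supported on K = N \ a and cancel. *)
      rewrite ltaj !inE eqxx ac cN aN ca /=.
      have -> : N :\ c :\ a = N :\ a :\ c by rewrite !setDDl setUC.
      rewrite setD1K ?inE ?ca ?cN //.
      rewrite !(mul0r, mulr0).
      have [_|_] := eqVneq K (N :\ a); last by rewrite !(mul0r, mulr0) addr0.
      have -> : cnt_lt a (N :\ c) = cnt_lt a N by rewrite (cnt_ltD1 a cN) ltnNge (ltnW ltaj).
      have -> : cnt_lt c (N :\ c) = cnt_lt c N by rewrite (cnt_ltD1 c cN) ltnn.
      rewrite exprS expr1; move: (pX (cnt_lt c N)) => h.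
      by rewrite /qhat; field; rewrite ?q0 h.
    rewrite ltaj !inE ?eqxx ?ca ?(negPf cN) !andbF /= !(mul0r, mulr0) add0r.
    have [cK|cK] := boolP (c \in K).
      rewrite !mul0r; case: eqP => [e|_]; last by rewrite !(mul0r, mulr0).
      by move: cK; rewrite e !inE (negPf cN) andbF.
    rewrite setU1_eq // !inE eqxx setU1K ?inE ?(negPf cN) ?andbF //=.
    case: eqP => [->|_]; last by rewrite !(mul0r, mulr0).
    rewrite (cnt_ltD1 c aN) ltaj exprD expr1 exprS expr0.
    move: (pX (cnt_lt c (N :\ a))) => h.
    by field; rewrite h.
  have jc : (j == c) = false by rewrite eq_sym; apply: negbTE.
  have ja : (j == a) = false by rewrite eq_sym; apply: negbTE.
  rewrite !inE ac ca ja jc aN /=.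
  have [cK|cK] := boolP (c \in K).
    have -> : (K == j |: N :\ c :\ a) = false.
      by apply/eqP => e; move: cK; rewrite e !inE (negPf cj) eqxx andbF.
    have -> : (K == j |: N :\ a :\ c) = false.
      by apply/eqP => e; move: cK; rewrite e !inE (negPf cj) eqxx.
    by rewrite !andbF !(mul0r, mulr0) addr0.
  rewrite setU1_eq // !inE (negPf cj) ca /=.
  have [jN|jN] := boolP (j \in N).
    by rewrite !andbF !(mul0r, mulr0) addr0.
  have [cN|cN] := boolP (c \in N); last by rewrite !andbF !(mul0r, mulr0) addr0.
  rewrite ?andbT ?andbF /=.
  have -> : (j |: N :\ a) :\ c = j |: N :\ c :\ a.
    by apply/setP => y; rewrite !inE; case: (eqVneq y j) => [->|_] /=; rewrite ?jc // andbCA.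
  have -> : N :\ a :\ c = N :\ c :\ a by rewrite !setDDl setUC.
  case: eqP => [->|_]; last by rewrite !andbF !(mul0r, mulr0) addr0.
  rewrite andbT.
  (* Removing a or c, or adding j, changes each count by at most one, according to the order of a, c
     and j. *)
  have e1 : cnt_lt c N = ((a < c) + cnt_lt c (N :\ c :\ a))%N.
    by rewrite (cnt_ltD1 c cN) ltnn (cnt_ltD1 c (j := a)) // !inE ac.
  have e2 : cnt_lt c (j |: N :\ c :\ a) = ((j < c) + cnt_lt c (N :\ c :\ a))%N.
    by rewrite cnt_lt_setU1 // !inE (negPf jN) !andbF.
  have e3 : cnt_lt c N = ((a < c) + cnt_lt c (N :\ a))%N by apply: cnt_ltD1.
  have e4 : cnt_lt a N = ((c < a) + cnt_lt a (N :\ c))%N by apply: cnt_ltD1.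
  have e5 : cnt_lt j N = ((c < j) + cnt_lt j (N :\ c))%N by apply: cnt_ltD1.
  have e6 : cnt_lt j N = (1 + cnt_lt j (N :\ a))%N by rewrite (cnt_ltD1 j aN) ltaj.
  have e7 : cnt_lt c (N :\ a) = cnt_lt c (N :\ c :\ a).
    by apply: (@addnI (a < c)%N); rewrite -e3 e1.
  rewrite e1 e2 e4 e7.
  have [ltac|ltca|e] := ltngtP a c; last by move: ac; rewrite (val_inj e) eqxx.
    have [ltcj|ltjc|e] := ltngtP c j; last by move: cj; rewrite (val_inj e) eqxx.
      have -> : cnt_lt j (N :\ a) = cnt_lt j (N :\ c) by move: e6; rewrite e5 ltcj => -[].
      rewrite e5 ltcj !add0n !add1n /= !exprS /qhat.
      by move: (pX (cnt_lt j (N :\ c))) => h; field; rewrite ?q0 h.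
    rewrite e5 ltnNge (ltnW ltjc) !add0n !add1n /= !exprS.
    by rewrite !(mul0r, mulr0) addr0.
  have ltcj : (c < j)%N by apply: ltn_trans ltaj.
  rewrite e5 ltcj [(j < c)%N]ltnNge (ltnW ltcj).
  rewrite !add0n !add1n /= !exprS !mul0r addr0.
  by move: (pX (cnt_lt j (N :\ c))) => h; field; rewrite ?q0 h.
- rewrite !mul0r !mulr0 add0r; have [ltac|] := ltnP a c; last by rewrite !(mul0r, mulr0).
  have ltjc := ltn_trans ltja ltac.
  rewrite ltnNge (ltnW ltjc); case: eqP => [e|_]; last by rewrite !(mul0r, mulr0).
  by move: ltjc; rewrite e ltnn.
Qed.

Lemma sum_eqr a N : \sum_(d in N) (a == d)%:R = (a \in N)%:R :> k.
Proof.
rewrite big_mkcond (bigD1 a) //= big1 ?addr0 => [|d]; first by rewrite eqxx; case: ifP.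
by rewrite eq_sym => /negPf ->; case: ifP.
Qed.

(** Fusion in the exterior factor: braiding a vector past the product of c and K amounts to braiding
    it past c and then past K. The powers of -q are the structure constants of that product. *)
Lemma braid1_fuse a c K j N :
  (c \notin K)%:R * (- q) ^+ cnt_lt c K * braid1 a (c |: K) j N =
  \sum_(d in N) \sum_l
    (- q) ^+ cnt_lt d N * braid11 a c l d * braid1 l K j (N :\ d).
Proof.
rewrite braid1_fuse_explicit.
have E d : \sum_l (- q) ^+ cnt_lt d N * braid11 a c l d * braid1 l K j (N :\ d) =
    (c == d)%:R * ((- q) ^+ cnt_lt c N * q ^+ (a == c) * braid1 a K j (N :\ c))
    + (a == d)%:R * ((a < c)%:R * (- q) ^+ cnt_lt a N * qhat q * braid1 c K j (N :\ a)).
  rewrite /braid11; under eq_bigr do rewrite mulrDr mulrDl.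
  rewrite big_split /= (bigD1 a) // big1 ?addr0 => [|l]; last first.
    by rewrite eq_sym => /negPf ->; rewrite !(mul0r, mulr0).
  rewrite [X in _ + X](bigD1 c) // [X in _ + (_ + X)]big1 ?addr0 => [|l]; last first.
    by rewrite eq_sym => /negPf ->; rewrite andbF !(mul0r, mulr0).
  rewrite !eqxx /=; congr (_ + _).
    by case: (eqVneq c d) => [<-|_]; rewrite ?(mul0r, mulr0) ?mul1r //; ring.
  by case: (eqVneq a d) => [<-|_]; rewrite /= ?(mul0r, mulr0) ?mul1r //; ring.
under [RHS]eq_bigr do rewrite E.
rewrite big_split /=; congr (_ + _).
  rewrite -mulr_suml -!mulrA; congr (_ * _).
  by rewrite -sum_eqr.
rewrite -mulr_suml !mulrA; congr (_ * _ * _ * _).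
by rewrite sum_eqr -natrM mulnb.
Qed.

End RowBraiding.

Lemma exchange_big22 (V : nmodType) (I1 I2 J1 J2 : finType)
    (F : I1 -> I2 -> J1 -> J2 -> V) :
  \sum_a \sum_b \sum_c \sum_d F a b c d = \sum_c \sum_d \sum_a \sum_b F a b c d.
Proof.
rewrite pair_bigA /= exchange_big /=; under eq_bigr => c _.
  rewrite exchange_big /=; under eq_bigr => d _.
    by rewrite -(pair_bigA _ (fun a b => F a b c d)) over.
  by over.
by [].
Qed.

(** The bijection sends c in K to the pair of c and K \ c. It turns a row or column expansion into
    the shape required by the fusion identities. *)
Lemma sum_setU1 (V : nmodType) (T : finType) (F : T -> {set T} -> V) :
  \sum_(K : {set T}) \sum_(c in K) F c K =
  \sum_c \sum_(K : {set T} | c \notin K) F c (c |: K).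
Proof.
rewrite (exchange_big_dep xpredT) //=; apply: eq_bigr => c _.
rewrite (reindex_onto (fun K => c |: K) (fun K => K :\ c)) /=; last first.
  by move=> K cK; rewrite setD1K.
apply: eq_bigl => K; rewrite !inE eqxx /=.
by apply/eqP/idP => [<-|/setU1K //]; rewrite !inE eqxx.
Qed.

(** * Commutation of one generator with a minor *)

Section RowCommutation.

Variables (k : fieldType) (n : nat) (q : k) (A : algType k).
Variable X : 'I_n -> 'I_n -> A.

Hypothesis Xcol : forall i l j : 'I_n, (i < l)%N ->
  X i j * X l j = q *: (X l j * X i j).
Hypothesis Xrow : forall i j m : 'I_n, (j < m)%N ->
  X i j * X i m = q *: (X i m * X i j).
Hypothesis Xanti : forall i l j m : 'I_n, (i < l)%N -> (m < j)%N ->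
  X i j * X l m = X l m * X i j.
Hypothesis Xdiag : forall i l j m : 'I_n, (i < l)%N -> (j < m)%N ->
  X i j * X l m - X l m * X i j = qhat q *: (X i m * X l j).
Hypothesis q0 : q != 0.

Implicit Types (a c d i j l m g : 'I_n) (J K M N T : {set 'I_n}).

Local Notation W := (wminor q X).

(** One formula covers all the defining relations: each relative order of i, m and of l, d reduces
    to one of them or to a trivial identity. *)
Lemma braid11_rel_explicit i m l d :
  q ^+ (l == d) *: (X i l * X m d) + ((d < l)%:R * qhat q) *: (X i d * X m l) =
  q ^+ (i == m) *: (X m d * X i l) + ((i < m)%:R * qhat q) *: (X i d * X m l).
Proof.
have [im|mi|/val_inj ->] := ltngtP i m.
- have -> : i == m = false by apply/eqP => e; rewrite e ltnn in im.
  have [ld|dl|/val_inj ->] := ltngtP l d.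
  + have -> : l == d = false by apply/eqP => e; rewrite e ltnn in ld.
    rewrite !expr0 !scale1r mul0r scale0r mul1r addr0.
    by have /eqP := Xdiag im ld; rewrite subr_eq addrC => /eqP.
  + have -> : l == d = false by apply/eqP => e; rewrite e ltnn in dl.
    by rewrite !expr0 !scale1r Xanti.
  + rewrite eqxx expr1 mul0r scale0r addr0 mul1r expr0 scale1r [X i d * X m d]Xcol //.
    by rewrite !scalerA /qhat mulrBl mulVf // scalerBl scale1r addrC subrK.
- have -> : i == m = false by apply/eqP => e; rewrite e ltnn in mi.
  rewrite mul0r scale0r addr0 expr0 scale1r.
  have [ld|dl|/val_inj ->] := ltngtP l d.
  + have -> : l == d = false by apply/eqP => e; rewrite e ltnn in ld.
    by rewrite expr0 scale1r mul0r scale0r addr0 (Xanti mi ld).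
  + have -> : l == d = false by apply/eqP => e; rewrite e ltnn in dl.
    rewrite expr0 scale1r mul1r -(Xanti mi dl).
    by have /eqP := Xdiag mi dl; rewrite subr_eq addrC => /eqP.
  + by rewrite eqxx expr1 mul0r scale0r addr0 (Xcol _ mi).
rewrite eqxx mul0r scale0r addr0 expr1.
have [ld|dl|/val_inj ->] := ltngtP l d.
- have -> : l == d = false by apply/eqP => e; rewrite e ltnn in ld.
  by rewrite expr0 scale1r mul0r scale0r addr0 (Xrow _ ld).
- have -> : l == d = false by apply/eqP => e; rewrite e ltnn in dl.
  rewrite expr0 mul1r (Xrow _ dl) !scalerA -scalerDl.
  by congr (_ *: _); rewrite /qhat; field.
- by rewrite eqxx expr1 mul0r scale0r addr0.
Qed.

Lemma braid11_rel i m l d :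
  \sum_a \sum_c braid11 q a c l d *: (X i a * X m c) =
  \sum_a \sum_c braid11 q i m a c *: (X c d * X a l).
Proof.
(* Both sides have coefficients supported on two pairs of indices; E evaluates any such double
   sum. *)
have E (x y : 'I_n) (b : bool) (r s : k) (F : 'I_n -> 'I_n -> A) :
    \sum_a \sum_c (((a == x) && (c == y))%:R * r + [&& a == y, c == x & b]%:R * s) *: F a c =
    r *: F x y + (b%:R * s) *: F y x.
  under eq_bigr => a _ do under eq_bigr => c _ do rewrite scalerDl.
  under eq_bigr => a _ do rewrite big_split.
  rewrite big_split /=; congr (_ + _).
    rewrite (bigD1 x) //= (bigD1 y) //= !big1 ?addr0 ?eqxx ?mul1r //.
      by move=> a /negPf ax; rewrite big1 // => c _; rewrite ax mul0r scale0r.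
    by move=> c /negPf cy; rewrite cy andbF mul0r scale0r.
  rewrite (bigD1 y) //= (bigD1 x) //= !big1 ?addr0 ?eqxx //.
    by move=> a /negPf ax; rewrite big1 // => c _; rewrite ax mul0r scale0r.
  by move=> c /negPf cy; rewrite cy andbF mul0r scale0r.
transitivity (q ^+ (l == d) *: (X i l * X m d) + ((d < l)%:R * qhat q) *: (X i d * X m l)).
  rewrite -(E l d _ _ _ (fun a c => X i a * X m c)).
  apply: eq_bigr => a _; apply: eq_bigr => c _; congr (_ *: _); rewrite /braid11.
  congr (_ + _); last by case: (eqVneq a d) => [->|//]; case: (eqVneq c l) => [->|].
  by case: (eqVneq a l) => [->|_]; case: (eqVneq c d) => [->|_]; rewrite /= ?mul0r.
rewrite braid11_rel_explicit -(E i m _ _ _ (fun a c => X c d * X a l)).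
apply: eq_bigr => a _; apply: eq_bigr => c _; congr (_ *: _); rewrite /braid11.
by rewrite (eq_sym a) (eq_sym c) (eq_sym a) (eq_sym c) andbCA.
Qed.

Lemma braid1_set0 a j N : braid1 q a set0 j N = ((a == j) && (N == set0))%:R.
Proof.
rewrite /braid1; case: eqP => _ /=; last first.
  have -> : (set0 == j |: N :\ a) = false.
    by apply/eqP => /setP/(_ j); rewrite !inE eqxx.
  by rewrite !andbF mul0r.
by rewrite eq_sym; case: eqP => [->|_]; rewrite ?inE ?mulr1 ?mul0r.
Qed.

(** Induction on the size of M, splitting off its least row m: fusion on the columns, an exchange of
    two generators, the induction hypothesis for the other rows, then fusion on the rows. *)
Lemma braid1_rel i j M N :
  \sum_a \sum_(K : {set 'I_n}) braid1 q a K j N *: (X i a * W (enum M) K) =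
  \sum_a \sum_(T : {set 'I_n}) braid1 q i M a T *: (W (enum T) N * X a j).
Proof.
move: {2}#|M| (erefl #|M|) => t; elim: t M N i j => [|t IH] M N i j Mt.
  move/eqP: Mt; rewrite cards_eq0 => /eqP ->; rewrite enum_set0 /=.
  transitivity ((N == set0)%:R *: X i j).
    rewrite (bigD1 j) //= [X in _ + X]big1 => [|a /negPf aj]; last first.
      apply: big1 => K _; have [->|_] := eqVneq K set0; last by rewrite mulr0 scaler0.
      by rewrite braid1_set0 aj scale0r.
    rewrite addr0 (bigD1 set0) //= big1 => [|K /negPf ->]; last by rewrite mulr0 scaler0.
    by rewrite addr0 !eqxx mulr1 braid1_set0 eqxx.
  rewrite (bigD1 i) //= [X in _ + X]big1 => [|a /negPf aj]; last first.
    by apply: big1 => T _; rewrite braid1_set0 eq_sym aj scale0r.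
  rewrite addr0 (bigD1 set0) //= big1 => [|T /negPf e]; last first.
    by rewrite braid1_set0 e andbF scale0r.
  by rewrite addr0 braid1_set0 !eqxx scale1r enum_set0 /= mulr_natl scaler_nat.
have [|m mM mi] := @min_elt _ M; first by rewrite -cards_eq0 Mt.
set M' := M :\ m in mi.
have mM' : m \notin M' by rewrite !inE eqxx.
have eM : M = m |: M' by rewrite setD1K.
have Mt' : #|M'| = t by move: Mt; rewrite eM cardsU1 mM' => -[].
have -> : enum M = m :: enum M' by rewrite eM enum_setU1_min.
(* Expansion along the row m, with K now the columns left after removing c. *)
transitivity (\sum_a \sum_c \sum_(K : {set 'I_n})
   ((c \notin K)%:R * (- q) ^+ cnt_lt c K * braid1 q a (c |: K) j N) *:
     (X i a * (X m c * W (enum M') K))).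
  apply: eq_bigr => a _.

  under eq_bigr do rewrite mulr_sumr scaler_sumr.
  rewrite sum_setU1; apply: eq_bigr => c _.
  rewrite big_mkcond; apply: eq_bigr => K _.
  case: ifP => cK; rewrite /= ?cK ?mul0r ?scale0r //.
  by rewrite -scalerAr scalerA mul1r cnt_lt_setU1 // ltnn setU1K // mulrC.
under eq_bigr => a _ do under eq_bigr => c _ do under eq_bigr => K _ do
  rewrite (braid1_fuse q0) scaler_suml.
transitivity (\sum_(d in N) (- q) ^+ cnt_lt d N *: \sum_l \sum_(K : {set 'I_n})
  braid1 q l K j (N :\ d) *: ((\sum_a \sum_c braid11 q a c l d *:
    (X i a * X m c)) * W (enum M') K)).
  under eq_bigr => a _ do under eq_bigr => c _ do rewrite exchange_big.
  under eq_bigr => a _ do rewrite exchange_big.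
  rewrite exchange_big; apply: eq_bigr => d _ /=.
  under eq_bigr => a _ do under eq_bigr => c _ do (under eq_bigr => K _
    do rewrite scaler_suml; rewrite exchange_big).
  rewrite exchange_big22 scaler_sumr; apply: eq_bigr => l _.
  rewrite scaler_sumr; apply: eq_bigr => K _.
  rewrite mulr_suml !scaler_sumr; apply: eq_bigr => a _.
  rewrite mulr_suml !scaler_sumr; apply: eq_bigr => c _.
  by rewrite -scalerAl !scalerA mulrA; congr (_ *: _); ring.
(* [braid11_rel] exchanges the two generators and leaves X a l next to the minor on M', as the
   induction hypothesis requires. *)
transitivity (\sum_(d in N) (- q) ^+ cnt_lt d N *: \sum_a \sum_c
  braid11 q i m a c *: (X c d * \sum_l \sum_(K : {set 'I_n}) braid1 q l K j (N :\ d) *: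
    (X a l * W (enum M') K))).
  apply: eq_bigr => d _; congr (_ *: _).
  under eq_bigr => l _ do under eq_bigr => K _ do rewrite braid11_rel mulr_suml scaler_sumr.
  under eq_bigr => l _ do under eq_bigr => K _ do under eq_bigr => a _
    do rewrite mulr_suml scaler_sumr.
  rewrite exchange_big22; apply: eq_bigr => a _; apply: eq_bigr => c _.
  rewrite mulr_sumr scaler_sumr; apply: eq_bigr => l _.
  rewrite mulr_sumr scaler_sumr; apply: eq_bigr => K _.
  by rewrite -scalerAl -scalerAr !scalerA mulrA mulrC.
under eq_bigr => d _ do under eq_bigr => a _ do under eq_bigr => c _ do rewrite IH //.
(* The sum over d is the first-row expansion of a minor with rows c followed by T. *)
transitivity (\sum_a \sum_c \sum_g \sum_(T : {set 'I_n}) (braid11 q i m a c * braid1 q a M' g T) *: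
   (W (c :: enum T) N * X g j)).
  under eq_bigr => d _ do rewrite scaler_sumr.
  rewrite exchange_big; apply: eq_bigr => a _ /=.
  under eq_bigr => d _ do rewrite scaler_sumr.
  rewrite exchange_big; apply: eq_bigr => c _ /=.
  under eq_bigr => d _ do rewrite mulr_sumr !scaler_sumr.
  rewrite exchange_big; apply: eq_bigr => g _ /=.
  under eq_bigr => d _ do rewrite mulr_sumr !scaler_sumr.
  rewrite exchange_big; apply: eq_bigr => T _ /=.
  rewrite mulr_suml scaler_sumr; apply: eq_bigr => d _.
  by rewrite -scalerAr -scalerAl !scalerA mulrA; congr (_ *: _); ring.
rewrite exchange_big22; apply: eq_bigr => g _.
(* [wminor_cons_set] sorts the row c into T, giving U; words with c in T contribute zero. *)
transitivity (\sum_(U : {set 'I_n}) \sum_(c in U) \sum_a ((- q) ^+ cnt_lt c U * braid11 q i m a c * braid1 q a M' g (U :\ c)) *: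
   (W (enum U) N * X g j)).
  rewrite sum_setU1.
  under eq_bigr => T _ do rewrite exchange_big.
  rewrite exchange_big; apply: eq_bigr => c _.
  rewrite [RHS]big_mkcond; apply: eq_bigr => T _; case: ifP => cT; last first.
    apply: big1 => a _; rewrite (wminor_cons_set Xrow Xanti Xdiag q0) cT.
    by rewrite mul0r scale0r mul0r scaler0.
  apply: eq_bigr => a _; rewrite (wminor_cons_set Xrow Xanti Xdiag q0) cT mul1r.
  rewrite cnt_lt_setU1 // ltnn setU1K // -scalerAl scalerA; congr (_ *: _).
  by rewrite /=; ring.
apply: eq_bigr => U _.
(* Two factors 1 are inserted to produce the left side of the fusion identity; since m is least, the
   exponent [cnt_lt m M'] is 0. *)
rewrite eM -[braid1 q i (m |: M') g U]mul1r -[1]mulr1.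
have {2}-> : 1 = (- q) ^+ cnt_lt m M' by rewrite cnt_lt0.
have {1}-> : 1 = (m \notin M')%:R :> k by rewrite mM'.
rewrite (braid1_fuse q0) scaler_suml; apply: eq_bigr => c _.
by rewrite scaler_suml.
Qed.

End RowCommutation.

(** * The braiding of two exterior powers *)

Section Heights.

Variable n : nat.
Implicit Types (a j x : 'I_n) (S J : {set 'I_n}) (m : nat).

Lemma cnt_ltS x S : cnt_lt x.+1 S = ((x \in S) + cnt_lt x S)%N.
Proof.
case: (boolP (x \in S)) => xS; last first.
  apply: eq_card => y; rewrite !inE ltnS leq_eqVlt.
  by case: eqP => // /val_inj ->; rewrite (negPf xS).
rewrite /cnt_lt (cardsD1 x) inE xS leqnn /=; congr (_ + _)%N.
apply: eq_card => y; rewrite !inE ltnS ltn_neqAle (inj_eq val_inj).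
by case: (y != x); rewrite ?andbF.
Qed.

Lemma cnt_lt_all m S : (n <= m)%N -> cnt_lt m S = #|S|.
Proof.
move=> nm; apply: eq_card => y; rewrite inE.
by rewrite (leq_trans (ltn_ord y) nm) andbT.
Qed.

Lemma cnt_lt_0 S : cnt_lt 0 S = 0%N.
Proof. by apply/eqP; rewrite cards_eq0; apply/eqP/setP => y; rewrite !inE andbF. Qed.

Definition height S J x : int := (cnt_lt x S)%:Z - (cnt_lt x J)%:Z.

(** A discrete intermediate value argument: the difference of the counts starts at 0 and drops by at
    most one per site, so it first becomes negative just after a site of J \ S of height 0. *)
Lemma height_crossing S J m : (cnt_lt m S < cnt_lt m J)%N ->
  exists x, [/\ x \in J, x \notin S & height S J x = 0].
Proof.
elim: m => [|m IH] h; first by rewrite !cnt_lt_0 in h.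
have [/IH //|h'] := ltnP (cnt_lt m S) (cnt_lt m J).
have [mn|nm] := ltnP m n; last by move: h h'; rewrite !cnt_lt_all ?leqW //; lia.
pose x := Ordinal mn; move: h; rewrite -[m]/(val x) !cnt_ltS /= => h.
exists x; rewrite /height -[nat_of_ord x]/m.
case: (x \in J) (x \in S) h => [] [] /= h; split => //; lia.
Qed.

End Heights.

(** The factors w are replaced by u one at a time from the left; the j-th summand is the change
    caused by the j-th replacement. *)
Lemma prod_telescope (R : comRingType) n (u w : 'I_n -> R) :
  \prod_x w x - \prod_x u x =
  \sum_(j < n) \prod_(x < n) (if (x < j)%N then u x else if (j < x)%N then w x else w x - u x).
Proof.
elim: n u w => [|n IH] u w; first by rewrite !big_ord0 subrr.
rewrite !big_ord_recr /=.
under [\sum_(j < n) _]eq_bigr => j _ do rewrite big_ord_recr /= ltnNge (ltnW (ltn_ord j)) ltn_ord.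
rewrite -mulr_suml -IH ltnn.
under [X in _ + X * _]eq_bigr do rewrite ltn_ord.
by ring.
Qed.

Section Braiding.

Variables (k : fieldType) (n : nat) (q : k).
Hypothesis q0 : q != 0.
Implicit Types (a c d i j l m x : 'I_n) (J K M N S T : {set 'I_n}).

(** The booleans [s], [s'], [j], [t] record membership of the site in S, S', J, N. The first test is
    the ice rule, which leaves six configurations. *)
Definition bweight (h : int) (s s' j t : bool) : k :=
  if (s + s' != j + t)%N then 0
  else if s && s' then q
  else if s || s' then (- q) ^ (- h) - (if j && ~~ s then (- q) ^ h else 0)
  else 1.

Definition braid S S' J N : k :=
  \prod_x bweight (height S J x) (x \in S) (x \in S') (x \in J) (x \in N).

Let p0 : - q != 0. Proof. by rewrite oppr_eq0. Qed.

(** The local fusion identity at the site a itself: the first term on the right becomes [u a] in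
    [braid_fuse], the second is [w a - u a]. *)
Lemma bweight_start h (s s' j t : bool) :
  (- q) ^ h * (~~ s)%:R * bweight h true s' j t =
  t%:R * bweight h s s' j false * (- q) ^+ j + j%:R * q ^+ t * bweight h s s' false t.
Proof.
have y0 : (- q) ^ h != 0 by apply: expfz_neq0.
rewrite /bweight -invr_expz; move: ((- q) ^ h) y0 => y y0.
case: s s' j t => [] [] [] [] /=;
  rewrite ?subr0 ?mul1r ?mul0r ?mulr0 ?add0r ?addr0 ?expr1 ?mulr1 ?mulfV //;
by field; rewrite ?y0 ?q0.
Qed.

(** The local fusion identity at a site above a, where adding a to S has raised the height by
    one. *)
Lemma bweight_step h (s s' j t : bool) :
  bweight (h + 1) s s' j t =
  bweight h s s' j t * (- q) ^- t * (- q) ^+ j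
  + (j && ~~ t)%:R * qhat q * bweight h s s' false true.
Proof.
have y0 : (- q) ^ h != 0 by apply: expfz_neq0.
rewrite /bweight -!invr_expz expfzDr // expr1z /qhat; move: ((- q) ^ h) y0 => y y0.
by case: s s' j t => [] [] [] [] /=; rewrite ?expr0 ?expr1 ?invr1 ?mulr1; field; rewrite ?y0 ?q0.
Qed.

(** Written as a product over sites, such a power merges with the product defining [braid]. *)
Lemma expr_cnt_lt (r : k) (m : nat) J :
  r ^+ cnt_lt m J = \prod_(x < n) (if (x < m)%N then r ^+ (x \in J) else 1).
Proof.
rewrite /cnt_lt -sum1_card big_mkcond expr_sum; apply: eq_bigr => x _.
by rewrite inE; case: (x \in J); case: ltnP; rewrite ?expr1 ?expr0.
Qed.

(** For given a, j and N, [braid1] is supported on at most one K. The exponent becomes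
    [cnt_lt a.+1 N], because a lies in N when the second branch is nonzero. *)
Lemma sum_braid1 a j N (F : {set 'I_n} -> k) :
  \sum_(K : {set 'I_n}) F K * braid1 q a K j N =
  if a == j then F N * q ^+ (a \in N)
  else [&& (a < j)%N, a \in N & j \notin N]%:R * qhat q *
    ((- q) ^+ cnt_lt a.+1 N * (- q) ^- cnt_lt j N) * F (j |: N :\ a).
Proof.
rewrite /braid1; case: eqP => _.
  rewrite (bigD1 N) //= big1 => [|K /negPf ->]; last by rewrite mul0r mulr0.
  by rewrite eqxx mul1r addr0.
rewrite (bigD1 (j |: N :\ a)) //= big1 => [|K /negPf ->]; last first.
  by rewrite !andbF mul0r mulr0.
rewrite addr0 eqxx andbT cnt_ltS; case: and3P => [[_ -> _]|]; last by rewrite !(mul0r, mulr0).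
by rewrite add1n; ring.
Qed.

Lemma braid_fuse a S S' J N : #|J| = #|S|.+1 ->
  (a \notin S)%:R * (- q) ^+ cnt_lt a S * braid (a |: S) S' J N =
  \sum_(j in J) \sum_(K : {set 'I_n})
    (- q) ^+ cnt_lt j J * braid S S' (J :\ j) K * braid1 q a K j N.
Proof.
move=> cJ.
(* The sum over j telescopes: at each site x, [w x] is the weight on the left and
   [u x] the weight on the right when j > x, so that the product of [u] over x < j,
   [w j - u j], and the product of [w] over x > j make the j-th summand. *)
pose h x := height S J x.
pose w x := if (x < a)%N then
    bweight (h x) (x \in S) (x \in S') (x \in J) (x \in N) * (- q) ^+ (x \in J)
  else if (a < x)%N then bweight (h x + 1) (x \in S) (x \in S') (x \in J) (x \in N)
  else (- q) ^ h a * (a \notin S)%:R * bweight (h a) true (a \in S') (a \in J) (a \in N).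
pose u x := if (x < a)%N then
    bweight (h x) (x \in S) (x \in S') (x \in J) (x \in N) * (- q) ^+ (x \in J)
  else if (a < x)%N then
    bweight (h x) (x \in S) (x \in S') (x \in J) (x \in N)
      * (- q) ^- (x \in N) * (- q) ^+ (x \in J)
  else (a \in N)%:R * bweight (h a) (a \in S) (a \in S') (a \in J) false * (- q) ^+ (a \in J).
have u0 : \prod_x u x = 0.
  (* As J has more elements than S, some site of J \ S has height 0, and there the weight p^-h -
     p^h, with p = -q, vanishes. *)
  have [|x [xJ xS hx]] := @height_crossing _ S J n; first by rewrite !cnt_lt_all ?cJ.
  suff ux : u x = 0 by rewrite (bigD1 x) //= ux mul0r.
  have b0 t t' : bweight 0 false t true t' = 0.
    by rewrite /bweight oppr0 expr0z; case: t t' => [] [] //=; rewrite subrr.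
  rewrite /u /h; case: ltngtP => [_|_|/val_inj xa]; first by rewrite hx xJ (negPf xS) b0 !mul0r.
    by rewrite hx xJ (negPf xS) b0 !mul0r.
  by rewrite -xa hx xJ (negPf xS) b0 !(mulr0, mul0r).
have wE : (a \notin S)%:R * (- q) ^+ cnt_lt a S * braid (a |: S) S' J N = \prod_x w x.
  have [aS|aS] := boolP (a \in S).
    by rewrite !mul0r (bigD1 a) //= {1}/w ltnn aS /= mulr0 !mul0r.
  (* The first factor stays at the site a, the second is spread over the sites below a. *)
  have -> : (- q) ^+ cnt_lt a S = (- q) ^ h a * (- q) ^+ cnt_lt a J.
    by rewrite !exprnP -expfzDr // subrK.
  rewrite mul1r -mulrA expr_cnt_lt -big_split /= (bigD1 a) //= [RHS](bigD1 a) //= mulrA.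
  congr (_ * _).
    rewrite /w /height !ltnn aS mul1r mulr1 cnt_lt_setU1 // ltnn add0n.
    by rewrite !inE eqxx.
  apply: eq_bigr => x xa; rewrite /w !inE (negPf xa) /height cnt_lt_setU1 //=.
  rewrite -/(height S J x); case: ltngtP => [xa'|ax|/val_inj e].
  - by rewrite mulrC.
  - by rewrite mul1r; congr (bweight _ _ _ _ _); rewrite /h /height; lia.
  - by rewrite e eqxx in xa.
rewrite wE -[LHS]subr0 -[X in _ - X]u0 prod_telescope [RHS]big_mkcond; apply: eq_bigr => j _.
have dE x : w x - u x = if (x < a)%N then 0 else if (a < x)%N then
    ((x \in J) && (x \notin N))%:R * qhat q * bweight (h x) (x \in S) (x \in S') false true
  else (a \in J)%:R * q ^+ (a \in N) * bweight (h a) (a \in S) (a \in S') false (a \in N).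
  rewrite /w /u; case: ltngtP => _; first by rewrite subrr.
    by rewrite bweight_step addrC addKr.
  by rewrite (bweight_start _ (a \in S)) addrC addKr.
have [jJ|jJ] := boolP (j \in J); last first.
  rewrite (bigD1 j) //= ltnn dE (negPf jJ).
  case: ltngtP => [_|_|/val_inj e]; rewrite -?e ?(negPf jJ) !mul0r //.
have hJ x : height S (J :\ j) x = h x + (j < x)%N.
  by rewrite /h /height (cnt_ltD1 x jJ); lia.
rewrite sum_braid1; case: (eqVneq a j) => [aj|aj].
  rewrite -{}aj in jJ hJ *.
  rewrite expr_cnt_lt mulrAC [X in X * _]mulrC -mulrA -big_split /=.
  rewrite (bigD1 a) //= [in RHS](bigD1 a) //= mulrA; congr (_ * _).
    by rewrite dE !ltnn !inE eqxx jJ hJ !ltnn addr0 !mul1r.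
  apply: eq_bigr => x xa; rewrite hJ /w /u !inE xa /=.
  case: ltngtP => [_|_|/val_inj e]; last by rewrite e eqxx in xa.
    by rewrite addr0 mulrC.
  by rewrite mul1r.
(* Outside the support of [braid1] the j-th summand also vanishes: if j < a or j is in N, then
   [w j - u j] is 0, and otherwise a is not in N and [u a] is 0. *)
case: and3P => [[aj' aN jN]|H]; last first.
  rewrite !(mul0r, mulr0).
  have [ja|aj'|/val_inj e] := ltngtP j a; last by rewrite e eqxx in aj.
    by rewrite (bigD1 j) //= ltnn dE ja mul0r.
  have [jN|jN] := boolP (j \in N).
    by rewrite (bigD1 j) //= ltnn dE ltnNge (ltnW aj') jN aj' andbF !mul0r.
  rewrite (bigD1 a) //= aj' /u ltnn; case: (boolP (a \in N)) => aN; last by rewrite !mul0r.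
  by case: H; split.
rewrite mul1r !expr_cnt_lt -prodfV -!big_split -mulrA -big_split /=.
rewrite (bigD1 j) //= [in RHS](bigD1 j) //= mulrA; congr (_ * _).
  have ja : (j < a)%N = false by rewrite ltnNge ltnW.
  have ja' : (j <= a)%N = false by rewrite leqNgt aj'.
  rewrite dE !ltnn ltnS ja ja' aj' jN jJ hJ ltnn addr0 !inE eqxx /=.
  by rewrite invr1 !mul1r.
apply: eq_bigr => x xj; rewrite hJ /w /u ltnS !inE (negPf xj) /=.
have r0 (t : nat) : (- q) ^+ t != 0 by apply: expf_neq0.
have [xa|ax|/val_inj ->] := ltngtP x a.
- have -> : (x < j)%N by apply: ltn_trans aj'.
  have -> : x != a by apply: contraTneq xa => ->; rewrite ltnn.
  have -> : (j < x)%N = false by rewrite ltnNge ltnW // (ltn_trans xa).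
  by rewrite addr0 mulfV // mul1r mulrC.
- have -> : x != a by apply: contraTneq ax => ->; rewrite ltnn.
  have [xj'|jx|/val_inj e] := ltngtP x j; last by rewrite e eqxx in xj.
    by rewrite addr0 mul1r; ring.
  by rewrite invr1 !mul1r.
have ja : (j < a)%N = false by rewrite ltnNge ltnW.
by rewrite ?leqnn aj' ja eqxx aN addr0 mulfV // mul1r mul1r mulrC.
Qed.

End Braiding.

(** * Commutation of two minors *)

Section Commutation.

Variables (k : fieldType) (n : nat) (q : k) (A : algType k).
Variable X : 'I_n -> 'I_n -> A.

Hypothesis Xcol : forall i l j : 'I_n, (i < l)%N ->
  X i j * X l j = q *: (X l j * X i j).
Hypothesis Xrow : forall i j m : 'I_n, (j < m)%N ->
  X i j * X i m = q *: (X i m * X i j).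
Hypothesis Xanti : forall i l j m : 'I_n, (i < l)%N -> (m < j)%N ->
  X i j * X l m = X l m * X i j.
Hypothesis Xdiag : forall i l j m : 'I_n, (i < l)%N -> (j < m)%N ->
  X i j * X l m - X l m * X i j = qhat q *: (X i m * X l j).
Hypothesis q0 : q != 0.

Implicit Types (a c d i j l m g : 'I_n) (I J K M N S T U : {set 'I_n}).

Local Notation W := (wminor q X).

Lemma braid_set0 M N : braid q set0 M set0 N = (M == N)%:R.
Proof.
case: eqVneq => [->|MN].
  apply: big1 => x _; rewrite /bweight /height !inE subrr oppr0 !expr0z.
  by case: (x \in N); rewrite ?subr0.
have [x xMN] : exists x, (x \in M) != (x \in N).
  apply/existsP; apply: contraNT MN => /existsPn H.
  by apply/eqP/setP => x; have := H x; rewrite negbK => /eqP.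
rewrite /braid (bigD1 x) //= /bweight !inE.
by case: (x \in M) (x \in N) xMN => [] [] //= _; rewrite mul0r.
Qed.

Lemma wminor_enum_neq I J : #|I| != #|J| -> W (enum I) J = 0.
Proof. by move=> IJ; apply: wminor_size; rewrite -cardE. Qed.

(** Induction on the size of I, splitting off its least row i: fusion on the columns, the induction
    hypothesis for the remaining rows, [braid1_rel] to move the row i past the other minor, then
    fusion on the rows. *)
Lemma braid_rel I J M N : #|I| = #|J| ->
  \sum_S \sum_(S' : {set 'I_n}) braid q S S' J N *: (W (enum I) S * W (enum M) S') =
  \sum_T \sum_(T' : {set 'I_n}) braid q I M T T' *: (W (enum T') N * W (enum T) J).
Proof.
move: {2}#|I| (erefl #|I|) => t; elim: t I J M N => [|t IH] I J M N It IJ.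
  have J0 : J = set0 by apply/eqP; rewrite -cards_eq0 -IJ It.
  move/eqP: It; rewrite cards_eq0 => /eqP ->; rewrite enum_set0 {}J0.
  transitivity (W (enum M) N).
    rewrite (bigD1 set0) //= [X in _ + X]big1 => [|S /negPf S0]; last first.
      by apply: big1 => S' _; rewrite S0 mul0r scaler0.
    rewrite addr0 eqxx (bigD1 N) //= big1 => [|S /negPf S0]; last first.
      by rewrite braid_set0 S0 scale0r.
    by rewrite braid_set0 eqxx scale1r mul1r addr0.
  rewrite (bigD1 set0) //= [X in _ + X]big1 => [|T T0]; last first.
    apply: big1 => T' _; rewrite [W (enum T) _]wminor_enum_neq ?mulr0 ?scaler0 //.
    by rewrite cards0 cards_eq0.
  rewrite addr0 enum_set0 /= eqxx (bigD1 M) //= big1 => [|T]; last first.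
    by rewrite eq_sym => /negPf T0; rewrite braid_set0 T0 scale0r.
  by rewrite braid_set0 eqxx scale1r mulr1 addr0.
have [|i iI mi] := @min_elt _ I; first by rewrite -cards_eq0 It.
set I' := I :\ i in mi.
have iI' : i \notin I' by rewrite !inE eqxx.
have eI : I = i |: I' by rewrite setD1K.
have It' : #|I'| = t by move: It; rewrite eI cardsU1 iI' => -[].
have Jt : #|J| = t.+1 by rewrite -IJ.
have -> : enum I = i :: enum I' by rewrite eI enum_setU1_min.
transitivity (\sum_a \sum_(S : {set 'I_n}) \sum_(S' : {set 'I_n})
   ((a \notin S)%:R * (- q) ^+ cnt_lt a S * braid q (a |: S) S' J N) *:
     (X i a * (W (enum I') S * W (enum M) S'))).
  under eq_bigr => S _ do under eq_bigr => S' _ do rewrite mulr_suml scaler_sumr.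
  under eq_bigr do rewrite exchange_big.
  rewrite sum_setU1; apply: eq_bigr => a _.
  rewrite big_mkcond; apply: eq_bigr => S _.
  case: ifP => aS; last by rewrite big1 // => S' _; rewrite !mul0r scale0r.
  apply: eq_bigr => S' _.
  by rewrite -scalerAl scalerA mul1r cnt_lt_setU1 // ltnn setU1K // mulrC mulrA.
transitivity (\sum_a \sum_(S : {set 'I_n}) \sum_(S' : {set 'I_n})
   (\sum_(j in J) \sum_(K : {set 'I_n})
    (- q) ^+ cnt_lt j J * braid q S S' (J :\ j) K * braid1 q a K j N) *:
     (X i a * (W (enum I') S * W (enum M) S'))).
  apply: eq_bigr => a _; apply: eq_bigr => S _; apply: eq_bigr => S' _.
  (* Fusion needs J to have one element more than S; for any other size of S the minor on rows I'
     and columns S is zero. *)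
  have [cS|cS] := eqVneq #|I'| #|S|; first by rewrite braid_fuse // Jt -cS It'.
  by rewrite [W (enum I') S]wminor_enum_neq // mul0r mulr0 !scaler0.
under eq_bigr => a _ do under eq_bigr => S _ do under eq_bigr => S' _ do rewrite scaler_suml.
transitivity (\sum_(j in J) (- q) ^+ cnt_lt j J *: \sum_a \sum_(K : {set 'I_n})
  braid1 q a K j N *: (X i a * \sum_(S : {set 'I_n}) \sum_(S' : {set 'I_n})
    braid q S S' (J :\ j) K *: (W (enum I') S * W (enum M) S'))).
  under eq_bigr => a _ do under eq_bigr => S _ do rewrite exchange_big.
  under eq_bigr => a _ do rewrite exchange_big.
  rewrite exchange_big; apply: eq_bigr => j _.
  rewrite scaler_sumr; apply: eq_bigr => a _.
  under eq_bigr => S _ do under eq_bigr => S' _ do rewrite scaler_suml.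
  under eq_bigr => S _ do rewrite exchange_big.
  rewrite exchange_big scaler_sumr; apply: eq_bigr => K _.
  rewrite mulr_sumr !scaler_sumr; apply: eq_bigr => S _.
  rewrite mulr_sumr !scaler_sumr; apply: eq_bigr => S' _.
  by rewrite -scalerAr !scalerA; congr (_ *: _); ring.
have IHj j K : j \in J -> \sum_(S : {set 'I_n}) \sum_(S' : {set 'I_n})
    braid q S S' (J :\ j) K *: (W (enum I') S * W (enum M) S') =
    \sum_T \sum_(T' : {set 'I_n}) braid q I' M T T' *: (W (enum T') K * W (enum T) (J :\ j)).
  move=> jJ; apply: IH => //; rewrite It'.
  by move: Jt; rewrite (cardsD1 j) jJ => -[].
under eq_bigr => j jJ do under eq_bigr => a _ do under eq_bigr => K _ do rewrite IHj //.
transitivity (\sum_(j in J) (- q) ^+ cnt_lt j J *: \sum_(T : {set 'I_n}) \sum_(T' : {set 'I_n})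
  braid q I' M T T' *: ((\sum_a \sum_(K : {set 'I_n})
     braid1 q a K j N *: (X i a * W (enum T') K)) * W (enum T) (J :\ j))).
  apply: eq_bigr => j _; congr (_ *: _).
  under eq_bigr => a _ do under eq_bigr => K _ do rewrite mulr_sumr scaler_sumr.
  under eq_bigr => a _ do under eq_bigr => K _ do under eq_bigr => T _
    do rewrite mulr_sumr scaler_sumr.
  rewrite exchange_big22; apply: eq_bigr => T _; apply: eq_bigr => T' _.
  rewrite mulr_suml scaler_sumr; apply: eq_bigr => a _.
  rewrite mulr_suml scaler_sumr; apply: eq_bigr => K _.
  by rewrite -scalerAl -scalerAr !scalerA mulrA mulrC.
under eq_bigr => j _ do under eq_bigr => T _ do under eq_bigr => T' _ do
  rewrite (braid1_rel Xcol Xrow Xanti Xdiag q0).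
(* The sum over j is the first-row expansion of a minor with rows g followed by T. *)
transitivity (\sum_(T : {set 'I_n}) \sum_(T' : {set 'I_n}) \sum_g \sum_(U' : {set 'I_n})
   (braid q I' M T T' * braid1 q i T' g U') *: (W (enum U') N * W (g :: enum T) J)).
  under eq_bigr => j _ do rewrite scaler_sumr.
  rewrite exchange_big; apply: eq_bigr => T _.
  under eq_bigr => j _ do rewrite scaler_sumr.
  rewrite exchange_big; apply: eq_bigr => T' _.
  under eq_bigr => j _ do rewrite mulr_suml !scaler_sumr.
  rewrite exchange_big; apply: eq_bigr => g _.
  under eq_bigr => j _ do rewrite mulr_suml !scaler_sumr.
  rewrite exchange_big; apply: eq_bigr => U' _.
  rewrite [W (g :: _) _]/= mulr_sumr scaler_sumr; apply: eq_bigr => j _.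
  by rewrite -scalerAr -scalerAl !scalerA mulrA; congr (_ *: _); ring.
transitivity (\sum_(U : {set 'I_n}) \sum_(U' : {set 'I_n}) \sum_(g in U) \sum_(T' : {set 'I_n})
   ((- q) ^+ cnt_lt g U * braid q I' M (U :\ g) T' * braid1 q i T' g U') *:
   (W (enum U') N * W (enum U) J)).
  under [RHS]eq_bigr => U _ do rewrite exchange_big.
  rewrite sum_setU1.
  under eq_bigr => T _ do rewrite exchange_big.
  rewrite exchange_big; apply: eq_bigr => g _.
  rewrite [RHS]big_mkcond; apply: eq_bigr => T _.
  rewrite exchange_big.
  case: ifP => gT; last first.
    apply: big1 => U' _; apply: big1 => T' _.
    by rewrite (wminor_cons_set Xrow Xanti Xdiag q0) gT mul0r scale0r mulr0 scaler0.
  apply: eq_bigr => U' _; apply: eq_bigr => T' _.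
  rewrite (wminor_cons_set Xrow Xanti Xdiag q0) gT mul1r.
  rewrite cnt_lt_setU1 // ltnn setU1K // -scalerAr scalerA; congr (_ *: _).
  by ring.
apply: eq_bigr => U _; apply: eq_bigr => U' _.
(* The size condition of the fusion identity again: for other sizes of U both sides vanish. *)
have [cU|cU] := eqVneq #|U| #|J|; last first.
  rewrite [W (enum U) J]wminor_enum_neq // mulr0 scaler0.
  by rewrite big1 // => g _; rewrite big1 // => T' _; rewrite scaler0.
rewrite eI -[braid q (i |: I') M U U']mul1r -[1]mulr1.
have {2}-> : 1 = (- q) ^+ cnt_lt i I' by rewrite cnt_lt0.
have {1}-> : 1 = (i \notin I')%:R :> k by rewrite iI'.
rewrite (braid_fuse q0) ?It' -?Jt // scaler_suml; apply: eq_bigr => g _.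
by rewrite scaler_suml.
Qed.

End Commutation.

(** * Closed form of the coefficients *)

Section IndexSetOrder.

Variable n : nat.
Implicit Types (S J U V : {set 'I_n}) (x : 'I_n).

Lemma cnt_lt_nth x0 J m : (m < #|J|)%N -> cnt_lt (nth x0 (enum J) m) J = m.
Proof. by move=> mJ; rewrite -[m]/(val (Ordinal mJ)) -enum_val_nth cnt_lt_enum_val. Qed.

Lemma cnt_lt_mono J m m' : (m <= m')%N -> (cnt_lt m J <= cnt_lt m' J)%N.
Proof.
move=> mm'; apply: subset_leq_card; apply/subsetP => x; rewrite !inE => /andP[-> xm].
exact: leq_trans mm'.
Qed.

Lemma cnt_lt_gt_nth x0 J m l : (l < cnt_lt m J)%N -> (nth x0 (enum J) l < m)%N.
Proof.
move=> lm; have lJ : (l < #|J|)%N.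
  by apply: leq_trans lm _; apply: subset_leq_card; apply/subsetP => x; rewrite inE => /andP[].
by rewrite ltnNge; apply/negP => /cnt_lt_mono -/(_ J); rewrite cnt_lt_nth // leqNgt lm.
Qed.

Lemma nth_lt_cnt_lt x0 J m l : (l < #|J|)%N -> (nth x0 (enum J) l < m)%N ->
  (l < cnt_lt m J)%N.
Proof.
move=> lJ h; apply: leq_trans (cnt_lt_mono J h).
by rewrite cnt_ltS cnt_lt_nth // -mem_enum mem_nth // -cardE.
Qed.

(** The l-th entry of S is at most that of J for every l exactly when each initial segment contains
    at least as many elements of S as of J. The order thus means that all heights are
    nonnegative. *)
Lemma iset_leP S J : #|S| = #|J| ->
  reflect (forall m, (cnt_lt m J <= cnt_lt m S)%N) (iset_le S J).
Proof.
move=> SJ; rewrite /iset_le all2E -!cardE SJ eqxx /=.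
have [x0 _|J0] := pickP [in J]; last first.
  have cJ : #|J| = 0%N by apply: eq_card0.
  have S0 : S = set0 by apply/eqP; rewrite -cards_eq0 SJ cJ.
  move/eqP: cJ; rewrite cards_eq0 => /eqP ->.
  by rewrite S0 enum_set0; constructor => m.
have sz : size (zip (enum S) (enum J)) = #|J| by rewrite size_zip -!cardE SJ minnn.
apply: (iffP (all_nthP (x0, x0))) => [H m|H l].
  case E : (cnt_lt m J) => [//|l].
  have lJ : (l < #|J|)%N.
    rewrite -E; apply: subset_leq_card; apply/subsetP => x.
    by rewrite inE => /andP[].
  have := H l; rewrite sz lJ nth_zip -?cardE ?SJ //= => /(_ isT) le.
  by apply: (@nth_lt_cnt_lt x0); rewrite ?SJ // (leq_ltn_trans le) // cnt_lt_gt_nth ?E.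
rewrite sz => lJ; rewrite nth_zip -?cardE ?SJ //=.
rewrite -ltnS; apply: cnt_lt_gt_nth; apply: leq_trans (H _).
by rewrite cnt_ltS cnt_lt_nth // -mem_enum mem_nth // -cardE.
Qed.

Lemma ell_sum U V : ell U V = (\sum_(z in U) cnt_lt z V)%N.
Proof.
rewrite /ell -sum1_card (eq_bigl (fun p => (p.1 \in U) && ((p.2 \in V) && (p.2 < p.1)%N)));
  last first.
  by move=> p; rewrite inE.
rewrite -(pair_big_dep (mem U) (fun z x : 'I_n => (x \in V) && (x < z)%N) (fun _ _ => 1%N)) /=.
by apply: eq_bigr => z _; rewrite sum1_card /cnt_lt; apply: eq_card => x; rewrite !inE.
Qed.

Lemma cnt_lt_setID x U V : cnt_lt x U = (cnt_lt x (U :&: V) + cnt_lt x (U :\: V))%N.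
Proof.
rewrite /cnt_lt -(cardsID V); congr (_ + _)%N; apply: eq_card => y; rewrite !inE //.
  by rewrite andbAC.
by rewrite andbA.
Qed.

Lemma height_setD S J x :
  height S J x = (cnt_lt x (S :\: J))%:Z - (cnt_lt x (J :\: S))%:Z.
Proof.
by rewrite /height (cnt_lt_setID x S J) (cnt_lt_setID x J S) setIC; lia.
Qed.

End IndexSetOrder.

Section ClosedForm.

Variables (k : fieldType) (n : nat) (q : k).
Hypothesis q0 : q != 0.
Implicit Types (I J M N S T U V Z : {set 'I_n}) (x : 'I_n).

(** With p = -q one has [qhat q] = p^-1 - p, so the product telescopes. *)
Lemma qbracketM m : qhat q * qbracket q m = (- q) ^ (- m%:Z) - (- q) ^ m%:Z.
Proof.
have p0 : - q != 0 by rewrite oppr_eq0.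
rewrite /qbracket mulr_sumr.
pose G (i : nat) := (- q) ^ (m%:Z - (2 * i)%N%:Z).
rewrite (eq_bigr (fun i : 'I_m => G i.+1 - G i)) => [|i _].
  rewrite -(big_mkord xpredT (fun i => G i.+1 - G i)) telescope_sumr // /G.
  by congr (_ ^ _ - _ ^ _); lia.
rewrite /G /qhat.
have -> : m%:Z - 1 - (2 * i)%N%:Z = m%:Z - (2 * i)%N%:Z - 1 by ring.
have -> : m%:Z - (2 * i.+1)%N%:Z = m%:Z - (2 * i)%N%:Z - 1 - 1 by lia.
move: (m%:Z - (2 * i)%N%:Z) => e; rewrite !expfzDr // !exprN1.
by move: ((- q) ^ e) => z; field; rewrite ?oppr_eq0 ?q0.
Qed.

(** An element of U is not in V, so counting up to it or strictly below it in V is the same; its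
    index in U, from 0, is [cnt_lt u U]. *)
Lemma xiE U V : [disjoint U & V] ->
  xi q U V = \prod_(u in U) qbracket q (cnt_lt u V - cnt_lt u U).
Proof.
move=> UV; rewrite big_enum_val; apply: eq_bigr => l _; rewrite cnt_lt_enum_val.
congr (qbracket _ (_ - _)); apply: eq_card => v; rewrite !inE leq_eqVlt.
case: eqP => // /val_inj ->; have /disjointFr -> := UV => //.
exact: enum_valP.
Qed.

(** Site by site: J and N in common give q, a site of J \ S gives [qhat q] times a bracket of the
    height, a site z of Z gives (-q)^-h(z), and any other site gives 1. *)
Lemma braid_closed S S' J N :
  S :&: S' = J :&: N -> S :|: S' = J :|: N ->
  (forall m, (cnt_lt m J <= cnt_lt m S)%N) ->
  let Z := (S :\: S') :|: (N :\: J) in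
  braid q S S' J N = q ^+ #|J :&: N| *
    (qhat q ^+ #|J :\: S| * (- q) ^ ((ell Z (J :\: S))%:Z - (ell Z (S :\: J))%:Z)
     * xi q (J :\: S) (S :\: J)).
Proof.
move=> eI eU hpos Z; have p0 : - q != 0 by rewrite oppr_eq0.
have -> : (- q) ^ ((ell Z (J :\: S))%:Z - (ell Z (S :\: J))%:Z) =
    \prod_(z in Z) (- q) ^ (- height S J z).
  rewrite !ell_sum expfzDr // -invr_expz -!exprnP !expr_sum -prodfV -big_split /=.
  apply: eq_bigr => z _; rewrite height_setD opprB expfzDr // -invr_expz -!exprnP //.
rewrite xiE; last by rewrite -setI_eq0; apply/eqP/setP => x; rewrite !inE; case: (x \in S);
  rewrite ?andbF.
rewrite -[q ^+ _]prodr_const -[qhat q ^+ _]prodr_const.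
rewrite big_mkcond [X in X * _ * _]big_mkcond [X in _ * X * _]big_mkcond.
rewrite [X in _ * _ * X]big_mkcond -!big_split /=.
apply: eq_bigr => x _.
(* Nonnegativity of the height makes the truncated subtraction exact. *)
have hx : height S J x = (cnt_lt x (S :\: J) - cnt_lt x (J :\: S))%N.
  by rewrite height_setD; move: (hpos x) (height_setD S J x); rewrite /height; lia.
move/setP: eI => /(_ x); move/setP: eU => /(_ x); rewrite !inE /bweight hx.
move: (cnt_lt x _ - cnt_lt x _)%N => d.
case: (x \in S) (x \in S') (x \in J) (x \in N) => [] [] [] [] //= _ _;
  by rewrite ?mulr1 ?mul1r ?subr0 ?qbracketM.
Qed.

(** The ice rule at every site forces the equalities of intersections and unions; a failure of S <=
    J yields a site of J \ S of height 0, whose weight is zero. *)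
Lemma braid_neq0 S S' J N : #|S| = #|J| -> braid q S S' J N != 0 ->
  [/\ S :&: S' = J :&: N, S :|: S' = J :|: N & iset_le S J].
Proof.
move=> SJ; rewrite /braid => nz.
have bx x : bweight q (height S J x) (x \in S) (x \in S') (x \in J) (x \in N) != 0.
  by apply: contraNneq nz => b0; rewrite (bigD1 x) //= b0 mul0r.
split.
- by apply/setP => x; rewrite !inE; move: (bx x);
    case: (x \in S) (x \in S') (x \in J) (x \in N) => [] [] [] [] //=;
    rewrite /bweight eqxx.
- by apply/setP => x; rewrite !inE; move: (bx x);
    case: (x \in S) (x \in S') (x \in J) (x \in N) => [] [] [] [] //=;
    rewrite /bweight eqxx.
apply/iset_leP => // m; rewrite leqNgt; apply/negP => /height_crossing[x [xJ xS hx]].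
move: (bx x); rewrite hx xJ (negPf xS) /bweight oppr0 !expr0z.
by case: (x \in S') (x \in N) => [] []; rewrite /= ?subrr eqxx.
Qed.

Lemma naturalE J N S S' : S :&: S' = J :&: N -> S :|: S' = J :|: N ->
  S' = natural J N S.
Proof.
move=> /setP eI /setP eU; apply/setP => x; move: (eI x) (eU x); rewrite !inE.
by case: (x \in S) (x \in S') (x \in J) (x \in N) => [] [] [] [].
Qed.

Lemma natural_setI J N S : S \subset J :|: N -> J :&: N \subset S ->
  S :&: natural J N S = J :&: N.
Proof.
move=> /subsetP SU /subsetP IS; apply/setP => x; move: (SU x) (IS x); rewrite !inE.
by case: (x \in S) (x \in J) (x \in N) => [] [] [] //= h1 h2; try (by case: (h1 isT));
  case: (h2 isT).
Qed.

Lemma natural_setU J N S : S \subset J :|: N -> J :&: N \subset S ->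
  S :|: natural J N S = J :|: N.
Proof.
move=> /subsetP SU /subsetP IS; apply/setP => x; move: (SU x) (IS x); rewrite !inE.
by case: (x \in S) (x \in J) (x \in N) => [] [] [] //= h1 h2; try (by case: (h1 isT));
  case: (h2 isT).
Qed.

Lemma card_natural J N S : S \subset J :|: N -> J :&: N \subset S ->
  #|S| = #|J| -> #|natural J N S| = #|N|.
Proof.
move=> SU IS SJ; have := cardsUI S (natural J N S).
by rewrite natural_setI // natural_setU // cardsUI SJ => /addnI.
Qed.

Lemma natural_self J N : natural J N J = N.
Proof.
by apply/setP => x; rewrite !inE; case: (x \in J); rewrite ?andbF ?orbF.
Qed.

Lemma iset_lexx S : iset_le S S.
Proof. by apply/iset_leP. Qed.

Lemma xi_set0 : xi q (set0 : {set 'I_n}) set0 = 1.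
Proof. by rewrite xiE ?big_set0 // -setI_eq0 set0I. Qed.

Lemma ell_set0 Z : ell Z set0 = 0%N.
Proof.
rewrite ell_sum big1 // => z _; apply/eqP; rewrite cards_eq0; apply/eqP/setP => x.
by rewrite !inE.
Qed.

Lemma lambda_coef_self J N : lambda_coef q J N J = 1.
Proof. by rewrite /lambda_coef /calL setDv !ell_set0 subrr cards0 xi_set0 expr0 expr0z !mulr1. Qed.

Lemma mu_coef_self I M : mu_coef q I M I = 1.
Proof. by rewrite /mu_coef /calLnat setDv !ell_set0 subrr cards0 xi_set0 expr0 expr0z !mulr1. Qed.

Lemma braid_lambda J N S : S \subset J :|: N -> J :&: N \subset S -> #|S| = #|J| ->
  iset_le S J -> braid q S (natural J N S) J N = q ^+ #|J :&: N| * lambda_coef q J N S.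
Proof.
move=> SU IS SJ le.
by rewrite braid_closed ?natural_setI ?natural_setU //; apply/iset_leP.
Qed.

(** Here I and M take the places of S and S', so the set Z of [braid_closed] is that of [calLnat] up
    to the order of the union. *)
Lemma braid_mu I M T : T \subset I :|: M -> I :&: M \subset T -> #|T| = #|I| ->
  iset_le I T -> braid q I M T (natural I M T) = q ^+ #|I :&: M| * mu_coef q I M T.
Proof.
move=> TU IT TI le.
rewrite braid_closed ?natural_setI ?natural_setU //; last by apply/iset_leP.
by rewrite /mu_coef /calLnat setUC.
Qed.

(** * Collapse of the braiding sums to the index sets of the identity *)

Variable (A : lmodType k).

(** A nonzero coefficient forces S' to be the set [natural J N S], so a single sum over S <= J
    remains. Its term S = J has coefficient 1 and is the leading product. *)
Lemma sum_braid_lower J N (F : {set 'I_n} -> {set 'I_n} -> A) :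
  (forall S S', #|S| != #|J| -> F S S' = 0) ->
  \sum_(S : {set 'I_n}) \sum_(S' : {set 'I_n}) braid q S S' J N *: F S S' =
  q ^+ #|J :&: N| *: F J N + q ^+ #|J :&: N| *:
    \sum_(S in lower_isets J N) lambda_coef q J N S *: F S (natural J N S).
Proof.
move=> F0.
transitivity (\sum_(S : {set 'I_n} | [&& S \subset J :|: N, J :&: N \subset S,
    #|S| == #|J| & iset_le S J])
    q ^+ #|J :&: N| *: (lambda_coef q J N S *: F S (natural J N S))).
  rewrite [RHS]big_mkcond; apply: eq_bigr => S _.
  have [SJ|SJ] := eqVneq #|S| #|J|; last first.
    by rewrite !andbF big1 // => S' _; rewrite F0 // scaler0.
  case: and4P => [[SU IS _ le]|H].
    rewrite (bigD1 (natural J N S)) //= big1 => [|S' S'n]; last first.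
      have [-> |/(braid_neq0 SJ)[eI eU _]] := eqVneq (braid q S S' J N) 0.
        by rewrite scale0r.
      by rewrite (naturalE eI eU) eqxx in S'n.
    by rewrite addr0 braid_lambda // scalerA.
  apply: big1 => S' _.
  have [-> |/(braid_neq0 SJ)[eI eU le]] := eqVneq (braid q S S' J N) 0.
    by rewrite scale0r.
  by case: H; split; rewrite // -?eI -?eU ?subsetUl ?subsetIl.
rewrite (bigD1 J) /=; last by rewrite subsetUl subsetIl eqxx iset_lexx.
rewrite lambda_coef_self scale1r natural_self scaler_sumr; congr (_ + _).
by apply: eq_bigl => S; rewrite inE /iset_lt !andbA.
Qed.

Lemma sum_braid_upper I M (F : {set 'I_n} -> {set 'I_n} -> A) :
  (forall T T', #|T| != #|I| -> F T T' = 0) ->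
  \sum_(T : {set 'I_n}) \sum_(T' : {set 'I_n}) braid q I M T T' *: F T T' =
  q ^+ #|I :&: M| *: F I M + q ^+ #|I :&: M| *:
    \sum_(T in upper_isets I M) mu_coef q I M T *: F T (natural I M T).
Proof.
move=> F0.
transitivity (\sum_(T : {set 'I_n} | [&& T \subset I :|: M, I :&: M \subset T,
    #|T| == #|I| & iset_le I T])
    q ^+ #|I :&: M| *: (mu_coef q I M T *: F T (natural I M T))).
  rewrite [RHS]big_mkcond; apply: eq_bigr => T _.
  have [TI|TI] := eqVneq #|T| #|I|; last first.
    by rewrite !andbF big1 // => T' _; rewrite F0 // scaler0.
  have IT := esym TI.
  case: and4P => [[TU IS _ le]|H].
    rewrite (bigD1 (natural I M T)) //= big1 => [|T' T'n]; last first.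
      have [-> |/(braid_neq0 IT)[eI eU _]] := eqVneq (braid q I M T T') 0.
        by rewrite scale0r.
      by rewrite (naturalE (esym eI) (esym eU)) eqxx in T'n.
    by rewrite addr0 braid_mu // scalerA.
  apply: big1 => T' _.
  have [-> |/(braid_neq0 IT)[eI eU le]] := eqVneq (braid q I M T T') 0.
    by rewrite scale0r.
  by case: H; split; rewrite // ?eI ?eU ?subsetUl ?subsetIl.
rewrite (bigD1 I) /=; last by rewrite subsetUl subsetIl eqxx iset_lexx.
rewrite mu_coef_self scale1r natural_self scaler_sumr; congr (_ + _).
by apply: eq_bigl => T; rewrite inE /iset_lt !andbA [I == T]eq_sym.
Qed.

End ClosedForm.

(** * The identity for quantum minors *)

Lemma qminorE (k : fieldType) n (q : k) (I J : {set 'I_n}) : (0 < n)%N ->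
  #|I| = #|J| -> qminor q I J = wminor q (Oq_X q) (enum I) J.
Proof.
move=> n0 IJ; pose x0 := Ordinal n0.
rewrite (@wminor_gminor _ _ _ _ _ #|I| _ _ x0) -?cardE //.
apply: eq_bigr => s _; congr (_ *: _); apply: eq_bigr => l _.
(* The two sides read [enum J] with different defaults, which agree because every index is below the
   size of J. *)
rewrite (enum_val_nth x0); congr (Oq_X _ _ _); apply: set_nth_default.
by rewrite -cardE -[X in (_ < X)%N]IJ.
Qed.

Theorem corollary5p3 (k : fieldType) (n : nat) (n_gt0 : (0 < n)%N)
    (q : k) (q_neq0 : q != 0) (I J M N : {set 'I_n})
    (cardIJ : #|I| = #|J|) (cardMN : #|M| = #|N|) :
  q ^+ #|J :&: N| *: (qminor q I J * qminor q M N)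
  + q ^+ #|J :&: N| *:
      (\sum_(S in lower_isets J N)
         lambda_coef q J N S *: (qminor q I S * qminor q M (natural J N S)))
  = q ^+ #|I :&: M| *: (qminor q M N * qminor q I J)
  + q ^+ #|I :&: M| *:
      (\sum_(T in upper_isets I M)
         mu_coef q I M T *: (qminor q (natural I M T) N * qminor q T J)).
Proof.
pose X := @Oq_X k n q; pose W (I J : {set 'I_n}) := wminor q X (enum I) J.
(* The braiding relation for the generators of the quantum matrix algebra; each side is then
   collapsed to a leading product and a sum over index sets. *)
have rel := braid_rel (@Oq_col k n q) (@Oq_row k n q) (@Oq_anti k n q)
  (@Oq_diag k n q) q_neq0 M N cardIJ.
rewrite (@sum_braid_lower _ _ _ q_neq0 _ _ _ (fun S S' => W I S * W M S')) in rel; last first.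
  by move=> S S' h; rewrite /W wminor_enum_neq ?mul0r // cardIJ eq_sym.
rewrite (@sum_braid_upper _ _ _ q_neq0 _ _ _ (fun T T' => W T' N * W T J)) in rel; last first.
  by move=> T T' h; rewrite [W T J]wminor_enum_neq ?mulr0 // -cardIJ.
rewrite !qminorE //.
rewrite (eq_bigr (fun S => lambda_coef q J N S *: (W I S * W M (natural J N S)))); last first.
  by move=> S; rewrite inE => /and4P[SU IS /eqP SJ _]; rewrite !qminorE ?card_natural // SJ.
rewrite [X in _ = _ + _ *: X](eq_bigr (fun T => mu_coef q I M T *:
  (W (natural I M T) N * W T J))) //.
by move=> T; rewrite inE => /and4P[TU IT /eqP TI _]; rewrite !qminorE ?card_natural // TI.
Qed.
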